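(* Let $G$ be an infinite finitely generated group of weakly polynomial growth. Then there exist a positive integer $n$ and a group homomorphism $G\to GL(n,\mathbb{R})$ with infinite image.
   Context: Let $G$ be a finitely generated group and let $B_G(r)\subset G$ denote the ball of radius $r$ centered at the identity with respect to some fixed word norm on $G$ (coming from a finite generating set). $G$ has weakly polynomial growth if for some $d\in(0,\infty)$ one has $\liminf_{r\to\infty}|B_G(r)|/r^{d}<\infty$. *)

(* Defs.v *)
From HB Require Import structures.
From mathcomp Require Import all_boot all_order all_algebra finmap.
From mathcomp Require Import all_classical all_reals all_analysis.

Set Implicit Arguments.
Unset Strict Implicit.
Unset Printing Implicit Defensive.

Import Order.TTheory GRing.Theory Num.Theory.
Import numFieldNormedType.Exports.

Local Open Scope classical_set_scope.
Local Open Scope ring_scope.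

(* The library's {'GL_n[R]} is restricted to finite rings, and 'M[R]_n is a
   unitRingType only for n of the form _.+1, hence this type. *)
Record GL (n : nat) (R : comUnitRingType) :=
  MkGL { GLmx :> 'M[R]_n; GLmx_unit : GLmx \in unitmx }.

HB.instance Definition _ n R := [isSub for @GLmx n R].
HB.instance Definition _ n R := [Choice of GL n R by <:].

Section GLGroup.
Context {n : nat} {R : comUnitRingType}.
Implicit Types A B : GL n R.

Definition GL_one : GL n R := MkGL (unitmx1 R n).

Lemma GL_mul_unit A B : GLmx A *m GLmx B \in unitmx.
Proof. by rewrite unitmx_mul !GLmx_unit. Qed.
Definition GL_mul A B : GL n R := MkGL (GL_mul_unit A B).

Lemma GL_inv_unit A : invmx (GLmx A) \in unitmx.
Proof. by rewrite unitmx_inv GLmx_unit. Qed.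
Definition GL_inv A : GL n R := MkGL (GL_inv_unit A).

Lemma GL_mulA : associative GL_mul.
Proof. by move=> A B C; apply: val_inj; rewrite /= mulmxA. Qed.
Lemma GL_mul1 : left_id GL_one GL_mul.
Proof. by move=> A; apply: val_inj; rewrite /= mul1mx. Qed.
Lemma GL_mulr1 : right_id GL_one GL_mul.
Proof. by move=> A; apply: val_inj; rewrite /= mulmx1. Qed.
Lemma GL_mulV : left_inverse GL_one GL_inv GL_mul.
Proof. by move=> A; apply: val_inj; rewrite /= mulVmx // GLmx_unit. Qed.
Lemma GL_mulrV : right_inverse GL_one GL_inv GL_mul.
Proof. by move=> A; apply: val_inj; rewrite /= mulmxV // GLmx_unit. Qed.
End GLGroup.

HB.instance Definition _ n R :=
  isGroup.Build (GL n R) GL_mulA GL_mul1 GL_mulr1 GL_mulV GL_mulrV.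

Section WordNorm.
Context {G : groupType}.
Implicit Types (S : {fset G}) (g : G) (w : seq G).

Definition is_word S w : bool := all (fun x => (x \in S) || (x^-1%g \in S)) w.

Definition spelled S g (k : nat) : Prop :=
  exists w, [/\ is_word S w, size w = k & (\prod_(x <- w) x)%g = g].

Definition generates S : Prop := forall g, exists k, spelled S g k.

Lemma generates_spelled S (genS : generates S) g :
  exists k, (fun k => `[< spelled S g k >]) k.
Proof. by have [k gk] := genS g; exists k; apply/asboolP. Qed.

Definition word_norm S (genS : generates S) g : nat :=
  ex_minn (generates_spelled genS g).

Definition word_ball (R : realType) S (genS : generates S) (r : R) : set G :=
  [set g | (word_norm genS g)%:R <= r].

Lemma finite_spelled S k : finite_set [set g | spelled S g k].
Proof.
elim: k => [|k IHk].
  apply: (@sub_finite_set _ _ [set 1%g]); last exact: finite_set1.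
  by move=> g [w [_ /size0nil -> <-]]; rewrite big_nil.
pose L : set G := [set` S] `|` (fun x => x^-1%g) @` [set` S].
have finL : finite_set L.
  by rewrite finite_setU; split; [|apply: finite_image]; exact: finite_fset.
apply: sub_finite_set (finite_image2 (fun x y : G => (x * y)%g) finL IHk).
move=> g [[|x w] [//= /andP[xS wS] [sw]]]; rewrite big_cons => <-.
exists x; last by exists (\prod_(y <- w) y)%g => //; exists w.
case/orP: xS => xS; [by left|right].
by exists (x^-1)%g => //; rewrite invgK.
Qed.

Lemma finite_word_ball (R : realType) S (genS : generates S) (r : R) :
  finite_set (word_ball genS r).
Proof.
have finU : finite_set (\bigcup_(k in `I_(Num.truncn r).+1)
    [set g | spelled S g k]).
  by apply: bigcup_finite => [|k _]; [exact: finite_II|exact: finite_spelled].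
apply: sub_finite_set finU => g; rewrite /word_ball /= /word_norm.
case: ex_minnP => k /asboolP gk _ kr; exists k => //=.
by rewrite -(ltr_nat R) (le_lt_trans kr)// truncnS_gt.
Qed.

(* fset_set is the genuine finite set here, by finite_word_ball. *)
Definition growth (R : realType) S (genS : generates S) (r : R) : nat :=
  #|` fset_set (word_ball genS r)|.

Definition weakly_polynomial_growth (R : realType) S (genS : generates S)
    : Prop :=
  exists2 d : R, 0 < d &
    (limf_einf (fun r : R => ((growth genS r)%:R / r `^ d)%:E) (pinfty_nbhs R)
      < +oo)%E.

End WordNorm.

(* Main.v *)
Require Import Defs.
From HB Require Import structures.
From mathcomp Require Import all_boot all_order all_algebra finmap.
From mathcomp Require Import all_classical all_reals all_analysis.
From mathcomp Require Import ring lra.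

Set Implicit Arguments.
Unset Strict Implicit.
Unset Printing Implicit Defensive.

Import Order.TTheory GRing.Theory Num.Theory.
Import numFieldNormedType.Exports.

Local Open Scope classical_set_scope.
Local Open Scope ring_scope.

(** The representation comes from the translation action of G on Lipschitz
harmonic functions of a random walk on G. Two facts are needed: the space of
these functions has finite dimension, and it contains a nonconstant function.
The action on it then has infinite image: if finitely many matrices occurred,
a nonconstant harmonic function would take finitely many values, hence attain
its maximum, and the maximum principle would make it constant.

Fix the uniform walk on a finite list T of steps, with Markov operator P, and
let p_n be the law of the walk from the identity after n steps. For a harmonic
f let e(f) be the mean of the squared increments of f over one step.

Finite dimension rests on the entropy H(n) of p_n. Since p_n lives on a ball,
H(n) is at most the logarithm of the size of that ball, so polynomial growth
along a sequence of radii forces H(n+1) - H(n) <= (D+1)/(n+1) for infinitely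
many n. This increment is the mean over the steps t of the relative entropy of
the law p_n started from t with respect to p_{n+1}; it bounds the chi-square
distance of the two laws because the density is at most |T|. As f has the same
mean value under all these laws up to its own increments, Cauchy-Schwarz gives
the reverse Poincare inequality
   e(f)(x) <= K * (1/(n+1)) * sum_{k <= n} (P^k e(f))(x)
for infinitely many n, with K independent of f and of x. Two consequences
follow. Bounded harmonic functions are constant (bounded_harmonic_cst), since
the sum on the right is a variance, which is bounded. And for
Lipschitz harmonic f_1, ..., f_d, independent modulo constants, the time
averages of the polarised energies have limits M_ij along an ultrafilter, these
limits are bounded harmonic functions of the base point, hence constants, and
e(sum c_i f_i)(x) <= K c M c^T. So M is invertible and every vector u of
increments of the f_i satisfies u M^-1 u^T <= K |T|. Averaging this over the
walk turns the left side into tr (M^-1 M) = d, whence d <= K |T|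
(size_independent_le).

For existence, compare translates of p_k in the l^2 inner product, where
<p_k(x^-1 .), p_l(z^-1 .)> = p_{k+l}(x^-1 z) because T is symmetric. Put
a(m) = p_m(1). Twice the drop a(2k) - a(2k+1) is the mean squared length of
the displacements t.p_k - p_k, and the second difference of a at 2k is the
squared length of the Laplacian of p_k. A point at distance 2k+1 carries p_k to
a translate orthogonal to p_k, so the triangle inequality bounds the drop below
by 1/(4 |T| (k+1)^2 |ball k|). If the second difference were at least a fixed
multiple of the drop for all k, the drop would decay geometrically, which
polynomial growth along a sequence forbids. Hence there are k for which the
Laplacian of p_k is small relative to the displacement s.p_k - p_k of the step
s that moves p_k most. The matrix coefficients
x |-> <x.p_k - p_k, s.p_k - p_k> / |s.p_k - p_k|^2 are 1-Lipschitz, almost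
harmonic and equal to 1 at s; a pointwise limit is the required function
(nonconstant_harmonic_exists). *)

(** * The random walk of a finite sequence of steps *)

Section RandomWalk.
Context {R : realType} {G : groupType} (T : seq G).
Implicit Types (F H : G -> R) (x y z : G) (n : nat).

Definition avg F x : R := (size T)%:R^-1 * \sum_(t <- T) F (x * t)%g.

Definition walk n F : G -> R := iter n avg F.

(** The probability that the walk started at x is at y after n steps. *)
Definition trans_prob n x y : R := walk n (fun z => (z == y)%:R) x.

Fixpoint reach n : seq G :=
  if n is n'.+1 then undup [seq (t * x)%g | t <- T, x <- reach n'] else [:: 1%g].

Lemma walkS n F x : walk n.+1 F x = avg (walk n F) x.
Proof. by []. Qed.

Lemma walkSr n F x : walk n.+1 F x = walk n (avg F) x.
Proof. by rewrite /walk iterSr. Qed.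

Lemma walk_add m n F x : walk (m + n) F x = walk m (walk n F) x.
Proof. by rewrite /walk iterD. Qed.

Lemma eq_avg F H x : (forall t, t \in T -> F (x * t)%g = H (x * t)%g) ->
  avg F x = avg H x.
Proof. by move=> FH; congr (_ * _); exact: eq_big_seq. Qed.

Lemma avg_lin a F H x : avg (fun y => a * F y + H y) x = a * avg F x + avg H x.
Proof. by rewrite /avg big_split/= -big_distrr/= mulrDr mulrCA. Qed.

Lemma walk_lin n a F H x :
  walk n (fun y => a * F y + H y) x = a * walk n F x + walk n H x.
Proof.
elim: n x => [//|n IHn] x; rewrite !walkS -avg_lin.
by apply: eq_avg => t _; exact: IHn.
Qed.

Lemma eq_walk n F H x : F =1 H -> walk n F x = walk n H x.
Proof. by move=> /funext ->. Qed.

Lemma avg_ge0 F x : (forall t, t \in T -> 0 <= F (x * t)%g) -> 0 <= avg F x.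
Proof.
by move=> F0; rewrite /avg mulr_ge0 ?invr_ge0// big_seq sumr_ge0.
Qed.

Lemma walk_ge0 n F x : (forall y, 0 <= F y) -> 0 <= walk n F x.
Proof.
by move=> F0; elim: n x => [//|n IHn] x; apply: avg_ge0 => t _; exact: IHn.
Qed.

Lemma trans_ge0 n x y : 0 <= trans_prob n x y.
Proof. by apply: walk_ge0 => z; rewrite ler0n. Qed.

Lemma walk0 n x : walk n (fun=> 0) x = 0.
Proof.
by elim: n x => [//|n IHn] x; rewrite walkS /avg big1 ?mulr0// => t _; rewrite IHn.
Qed.

Lemma walkD n F H x :
  walk n (fun y => F y + H y) x = walk n F x + walk n H x.
Proof.
rewrite -[walk n F x]mul1r -walk_lin.
by apply: eq_walk => y; rewrite mul1r.
Qed.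

Lemma walkZ n a F x : walk n (fun y => a * F y) x = a * walk n F x.
Proof.
rewrite -[RHS]addr0 -(walk0 n x) -walk_lin.
by apply: eq_walk => y; rewrite addr0.
Qed.

Lemma walkB n F H x :
  walk n (fun y => F y - H y) x = walk n F x - walk n H x.
Proof.
rewrite -[- walk n H x]mulN1r -walkZ -walkD.
by apply: eq_walk => y; rewrite mulN1r.
Qed.

Lemma walk_sum (I : Type) (r : seq I) n (F : I -> G -> R) x :
  walk n (fun y => \sum_(i <- r) F i y) x = \sum_(i <- r) walk n (F i) x.
Proof.
elim: r => [|i r IHr].
  by rewrite big_nil -[RHS](walk0 n x); apply: eq_walk => y; rewrite big_nil.
rewrite big_cons -IHr -walkD.
by apply: eq_walk => y; rewrite big_cons.
Qed.

Lemma le_walk n F H x : (forall y, F y <= H y) -> walk n F x <= walk n H x.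
Proof.
move=> FH; rewrite -subr_ge0 -walkB; apply: walk_ge0 => y.
by rewrite subr_ge0.
Qed.

Lemma walk_translate n F g x :
  walk n (fun y => F (g * y)%g) x = walk n F (g * x)%g.
Proof.
elim: n x => [//|n IHn] x; rewrite !walkS; congr (_ * _).
by apply: eq_bigr => t _; rewrite IHn mulgA.
Qed.

Lemma trans_translate n g x y : trans_prob n (g * x)%g (g * y)%g = trans_prob n x y.
Proof.
rewrite /trans_prob -walk_translate; apply: eq_walk => z.
by rewrite (inj_eq (mulgI g)).
Qed.

Lemma transS n x y :
  trans_prob n.+1 x y = (size T)%:R^-1 * \sum_(t <- T) trans_prob n (x * t)%g y.
Proof. by []. Qed.

Lemma trans0 x y : trans_prob 0 x y = (x == y)%:R.
Proof. by []. Qed.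

Lemma reach_uniq n : uniq (reach n).
Proof. by case: n => //= n; exact: undup_uniq. Qed.

Lemma reachSP n y : reflect (exists t x, [/\ t \in T, x \in reach n & y = t * x]%g)
  (y \in reach n.+1).
Proof.
apply: (iffP idP); rewrite mem_undup.
  by move=> /allpairsP[[t x]/= [tT xn ->]]; exists t, x.
by move=> [t [x [tT xn ->]]]; apply/allpairsP; exists (t, x).
Qed.

Lemma reachS n t x : t \in T -> x \in reach n -> (t * x)%g \in reach n.+1.
Proof. by move=> tT xn; apply/reachSP; exists t, x. Qed.

Lemma eq_walk_reach n F H x :
  (forall y, y \in reach n -> F (x * y)%g = H (x * y)%g) ->
  walk n F x = walk n H x.
Proof.
elim: n x => [|n IHn] x FH; first by rewrite -[x]mulg1; exact: FH (mem_head _ _).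
rewrite !walkS; apply: eq_avg => t tT; apply: IHn => y yn.
by rewrite -mulgA FH// reachS.
Qed.

(** The iterates of the Markov operator are finite sums over any finite set that
contains all points within reach. Convexity and the Cauchy-Schwarz inequality
are applied to these sums. *)
Lemma walkE n F x (A : seq G) : uniq A ->
  (forall y, y \in reach n -> (x * y)%g \in A) ->
  walk n F x = \sum_(y <- A) trans_prob n x y * F y.
Proof.
move=> uA xA.
transitivity (walk n (fun z => \sum_(y <- A) F y * (z == y)%:R) x).
  apply: eq_walk_reach => y yn.
  rewrite (bigD1_seq (x * y)%g) ?xA//= eqxx mulr1 big1 ?addr0// => z zxy.
  by rewrite eq_sym (negbTE zxy) mulr0.
by rewrite walk_sum; apply: eq_bigr => y _; rewrite walkZ mulrC.
Qed.

Lemma trans_support n x y : trans_prob n x (x * y)%g != 0 -> y \in reach n.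
Proof.
apply: contraNT => yn; apply/eqP; rewrite -[RHS](walk0 n x).
apply: eq_walk_reach => z zn; rewrite (inj_eq (mulgI x)).
by case: eqP => // zy; rewrite -zy zn in yn.
Qed.

Context (T1 : 1%g \in T).

Lemma sizeT_gt0 : 0 < (size T)%:R :> R.
Proof. by rewrite ltr0n; case: T T1. Qed.

Lemma avg_cst a x : avg (fun=> a) x = a.
Proof.
rewrite /avg big_const_seq count_predT iter_addr_0 -[a *+ _]mulr_natl mulrA.
by rewrite mulVf ?mul1r// gt_eqF ?sizeT_gt0.
Qed.

Lemma walk_cst n a x : walk n (fun=> a) x = a.
Proof.
elim: n x => [//|n IHn] x; rewrite walkS -[RHS](avg_cst a x).
by apply: eq_avg => t _; exact: IHn.
Qed.

Lemma walk_bounded n F M x : (forall y, `|F y| <= M) -> `|walk n F x| <= M.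
Proof.
move=> FM; rewrite ler_norml -{1}(walk_cst n (- M) x) -{2}(walk_cst n M x).
by apply/andP; split; apply: le_walk => y; have := FM y;
  rewrite ler_norml => /andP[].
Qed.

Lemma reach_le m n x : (m <= n)%N -> x \in reach m -> x \in reach n.
Proof.
move=> /subnK <-; elim: (n - m)%N => // k IHk xm.
by rewrite addSn -[x]mul1g reachS// IHk.
Qed.

Lemma one_reach n : 1%g \in reach n.
Proof. by apply: (@reach_le 0%N) => //; exact: mem_head. Qed.

End RandomWalk.

Arguments trans_prob {R G} T n x y : simpl never.
Arguments reach {G} T n : simpl never.

(** * Elementary inequalities *)

Section Inequalities.
Context {R : realType}.

(** Lagrange's identity: the difference of the two sides is half the sum of the
squares of the 2 x 2 minors. *)
Lemma cauchy_schwarz_sum (I : Type) (r : seq I) (u v : I -> R) :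
  (\sum_(i <- r) u i * v i) ^+ 2 <=
  (\sum_(i <- r) u i ^+ 2) * (\sum_(i <- r) v i ^+ 2).
Proof.
have : 0 <= \sum_(i <- r) \sum_(j <- r) (u i * v j - u j * v i) ^+ 2.
  by apply: sumr_ge0 => i _; apply: sumr_ge0 => j _; exact: sqr_ge0.
under eq_bigr => i _.
  under eq_bigr => j _.
    rewrite (_ : _ ^+ 2 = u i ^+ 2 * v j ^+ 2 + v i ^+ 2 * u j ^+ 2
      + - 2 * (u i * v i) * (u j * v j)); last by ring.
    over.
  rewrite !big_split/= -!mulr_sumr; over.
rewrite !big_split/= -!mulr_suml -mulr_sumr; lra.
Qed.

Lemma ln_leB1 (x : R) : 0 < x -> ln x <= x - 1.
Proof.
by move=> x0; have := @le_ln1Dx R (x - 1); rewrite addrCA subrr addr0; apply; lra.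
Qed.

(** Pointwise form of the bound of a chi-square distance by a relative entropy,
for a density p / q at most N. With a and b the square roots of p and q, the
inequality ln (b / a) <= b / a - 1 bounds (a - b)^2 by the entropy term, and
(a + b)^2 <= 2 (p + q) <= 2 (N + 1) q turns (a - b)^2 into (p - q)^2 / q. At
q = 0 both sides vanish, since 0 is its own inverse. *)
Lemma chi2_le_kl (N p q : R) : 0 <= p -> 0 <= q -> p <= N * q ->
  (p - q) ^+ 2 / q <= (N + 1) *+ 2 * (p * (ln p - ln q) - (p - q)).
Proof.
move=> p0 q0 pNq; have [q_0|q_n0] := eqVneq q 0.
  have -> : p = 0 by apply/eqP; rewrite eq_le p0 andbT (le_trans pNq)// q_0 mulr0.
  by rewrite q_0 invr0 !(mulr0, mul0r, subrr).
have {q_n0}q_gt0 : 0 < q by rewrite lt_neqAle eq_sym q_n0.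
have [p_0|p_n0] := eqVneq p 0.
  rewrite p_0 in p0 pNq *; rewrite mul0r !sub0r opprK sqrrN expr2 mulfK ?gt_eqF//.
  by rewrite -subr_ge0; nra.
have {p_n0}p_gt0 : 0 < p by rewrite lt_neqAle eq_sym p_n0.
set a := Num.sqrt p; set b := Num.sqrt q.
have a0 : 0 < a by rewrite sqrtr_gt0.
have b0 : 0 < b by rewrite sqrtr_gt0.
have pE : p = a ^+ 2 by rewrite sqr_sqrtr.
have qE : q = b ^+ 2 by rewrite sqr_sqrtr.
have lnab : ln b - ln a <= b / a - 1.
  by rewrite -ln_div ?posrE// ln_leB1// divr_gt0.
have kl : (a - b) ^+ 2 <= p * (ln p - ln q) - (p - q).
  rewrite {1 2}pE {1}qE !lnXn//.
  have : a ^+ 2 * (ln b - ln a) <= a ^+ 2 * (b / a - 1).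
    by rewrite ler_pM2l// exprn_gt0.
  have -> : a ^+ 2 * (b / a - 1) = a * b - a ^+ 2.
    by field; rewrite gt_eqF.
  rewrite pE qE !mulr2n; lra.
have : (p - q) ^+ 2 / q <= (N + 1) *+ 2 * (a - b) ^+ 2.
  rewrite ler_pdivrMr//.
  have -> : (p - q) ^+ 2 = (a - b) ^+ 2 * (a + b) ^+ 2 by rewrite pE qE; ring.
  have : (a - b) ^+ 2 * (a + b) ^+ 2 <= (a - b) ^+ 2 * ((N + 1) *+ 2 * q).
    apply: ler_wpM2l; first exact: sqr_ge0.
    have := sqr_ge0 (a - b); rewrite pE qE in pNq *; rewrite mulr2n; lra.
  lra.
move=> /le_trans; apply; apply: ler_wpM2l => //.
have N0 : 0 <= N by rewrite -(pmulr_lge0 _ q_gt0) (le_trans p0).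
by rewrite mulrn_wge0// addr_ge0.
Qed.

End Inequalities.

(** * Entropy of the walk and increments of harmonic functions *)

Section Entropy.
Context {R : realType} {G : groupType} (T : seq G) (T1 : 1%g \in T).
Implicit Types (f h : G -> R) (g s t x y z : G) (n : nat).

Local Notation avg := (@avg R G T).
Local Notation walk := (@walk R G T).
Local Notation trans_prob := (@trans_prob R G T).
Local Notation reach := (@reach G T).
Local Notation N := ((size T)%:R : R).

Definition entropy n : R := - walk n (fun y => ln (trans_prob n 1%g y)) 1%g.

Lemma sum_trans n x (A : seq G) : uniq A ->
  (forall y, y \in reach n -> (x * y)%g \in A) -> \sum_(y <- A) trans_prob n x y = 1.
Proof.
move=> uA xA; rewrite -[RHS](@walk_cst R _ _ T1 n 1 x) (walkE _ uA)//.
by under [RHS]eq_bigr do rewrite mulr1.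
Qed.

(** Among the laws on a finite set the uniform one has the largest entropy. *)
Lemma entropy_le n : entropy n <= ln (size (reach n))%:R.
Proof.
have uA := @reach_uniq _ T n.
have A1 y : y \in reach n -> (1 * y)%g \in reach n by rewrite mul1g.
have M0 : 0 < (size (reach n))%:R :> R.
  by rewrite ltr0n; have := one_reach T1 n; case: (reach n).
rewrite /entropy (walkE _ uA A1) -sumrN -subr_ge0.
have -> : ln (size (reach n))%:R
    = \sum_(y <- reach n) (trans_prob n 1%g y * ln (size (reach n))%:R) :> R.
  by rewrite -mulr_suml sum_trans// mul1r.
rewrite -sumrB.
apply: (@le_trans _ _
  (\sum_(y <- reach n) (trans_prob n 1%g y - (size (reach n))%:R^-1))).
  rewrite sumrB sum_trans// big_const_seq count_predT iter_addr_0.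
  by rewrite -[_^-1 *+ _]mulr_natl mulfV ?subrr// gt_eqF.
apply: ler_sum => y _; rewrite opprK -mulrDr.
have [->|p_n0] := eqVneq (trans_prob n 1%g y) 0.
  by rewrite mul0r sub0r oppr_le0 invr_ge0 ltW.
have p0 : 0 < trans_prob n 1%g y by rewrite lt_neqAle eq_sym p_n0 trans_ge0.
rewrite -lnM ?posrE// -[ln _]opprK -lnV ?posrE ?mulr_gt0//.
have := @ln_leB1 R ((size (reach n))%:R * trans_prob n 1%g y)^-1.
rewrite invr_gt0 mulr_gt0// => /(_ isT) h.
have := ler_wpM2l (ltW p0) h.
rewrite invfM mulrBr mulr1 mulrCA mulfV ?mulr1// mulrN; lra.
Qed.

Lemma trans_step_le n t y : t \in T -> trans_prob n t y <= N * trans_prob n.+1 1%g y.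
Proof.
move=> tT; rewrite transS mulrA mulfV ?gt_eqF ?sizeT_gt0// mul1r.
rewrite (big_rem t)//= mul1g lerDl sumr_ge0// => s _; exact: trans_ge0.
Qed.

Lemma trans_stepE n y : trans_prob n.+1 1%g y = N^-1 * \sum_(t <- T) trans_prob n t y.
Proof. by rewrite transS; under eq_bigr do rewrite mul1g. Qed.

(** The chi-square distance between two laws that differ in their first step: that
step is t for the first one and is random for the second one. *)
Definition chi2 n t : R := \sum_(y <- reach n.+1)
  (trans_prob n t y - trans_prob n.+1 1%g y) ^+ 2 / trans_prob n.+1 1%g y.

(** The law after n + 1 steps is the mean, over the first step t, of the laws after
n steps from t, which are translates of one another and so have equal entropy.
The concavity defect of the entropy is therefore a mean of relative entropies,
each of which dominates a chi-square distance. *)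
Lemma avg_chi2_le n :
  N^-1 * \sum_(t <- T) chi2 n t <= (N + 1) *+ 2 * (entropy n.+1 - entropy n).
Proof.
have uA := @reach_uniq _ T n.+1.
have A1 y : y \in reach n.+1 -> (1 * y)%g \in reach n.+1 by rewrite mul1g.
have At t y : t \in T -> y \in reach n -> (t * y)%g \in reach n.+1.
  by move=> tT yn; exact: reachS.
have entE t : t \in T ->
    entropy n = - \sum_(y <- reach n.+1) trans_prob n t y * ln (trans_prob n t y).
  move=> tT; rewrite /entropy -(walkE _ uA); last by move=> y; exact: At.
  congr (- _); rewrite -[in RHS](mulg1 t) -walk_translate.
  by apply: eq_walk => y; rewrite -(trans_translate T n t 1%g y) mulg1.
have -> : entropy n.+1 - entropy n = N^-1 * \sum_(t <- T)
    \sum_(y <- reach n.+1) (trans_prob n t y * (ln (trans_prob n t y)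
      - ln (trans_prob n.+1 1%g y)) - (trans_prob n t y - trans_prob n.+1 1%g y)).
  have -> : entropy n = N^-1 * \sum_(t <- T) entropy n.
    by have := @avg_cst R _ _ T1 (entropy n) 1%g.
  rewrite {1}/entropy (walkE _ uA A1).
  under eq_bigr do rewrite {1}trans_stepE -mulrA mulr_suml.
  rewrite -mulr_sumr exchange_big/= -mulrN -mulrBr -sumrN -sumrB.
  congr (_ * _); apply: eq_big_seq => t tT; rewrite (entE _ tT) opprK.
  (* The correction terms of the pointwise inequality cancel: both laws have
     total mass one. *)
  have mass0 : \sum_(y <- reach n.+1) (trans_prob n t y - trans_prob n.+1 1%g y) = 0.
    by rewrite sumrB !sum_trans ?subrr// => y; exact: At.
  rewrite [RHS]sumrB mass0 subr0 -sumrN -big_split/=; apply: eq_bigr => y _.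
  by rewrite addrC mulrBr.
rewrite mulrCA ler_pM2l ?invr_gt0 ?sizeT_gt0// mulr_sumr.
rewrite big_seq [leRHS]big_seq; apply: ler_sum => t tT.
rewrite mulr_sumr; apply: ler_sum => y _.
by apply: chi2_le_kl; rewrite ?trans_ge0 ?trans_step_le.
Qed.

Definition harmonic_fun f := forall x, avg f x = f x.

(** The carre du champ of the walk, as a bilinear form. *)
Definition energy f h x : R :=
  N^-1 * \sum_(t <- T) (f (x * t)%g - f x) * (h (x * t)%g - h x).

Lemma walk_harmonic f n x : harmonic_fun f -> walk n f x = f x.
Proof.
by move=> fh; elim: n => [//|n IHn]; rewrite walkSr -[RHS]IHn; apply: eq_walk.
Qed.

Lemma harmonic_translate g f : harmonic_fun f -> harmonic_fun (fun x => f (g * x)%g).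
Proof.
by move=> fh x; rewrite -[RHS]fh; congr (_ * _); apply: eq_bigr => t _; rewrite mulgA.
Qed.

Lemma energy_translate g f h x :
  energy (fun x => f (g * x)%g) (fun x => h (g * x)%g) x = energy f h (g * x)%g.
Proof. by congr (_ * _); apply: eq_bigr => t _; rewrite !mulgA. Qed.

Lemma sum_increments0 f x : harmonic_fun f -> \sum_(t <- T) (f (x * t)%g - f x) = 0.
Proof.
move=> fh; rewrite sumrB big_const_seq count_predT iter_addr_0.
rewrite -[X in _ - X *+ _]fh -[avg f x *+ _]mulr_natl /avg mulrA mulfV ?mul1r ?subrr//.
by rewrite gt_eqF ?sizeT_gt0.
Qed.

(** For harmonic f the cross term 2 (f x - c) (f (x * t) - f x) averages to zero. *)
Lemma avg_sqr f c x : harmonic_fun f ->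
  avg (fun y => (f y - c) ^+ 2) x = energy f f x + (f x - c) ^+ 2.
Proof.
move=> fh.
rewrite -[(f x - c) ^+ 2](@avg_cst R _ _ T1 _ x) /avg /energy -mulrDr -big_split/=.
congr (_ * _); apply/eqP; rewrite -subr_eq0 -sumrB.
rewrite (eq_bigr (fun t => (f x - c) *+ 2 * (f (x * t)%g - f x))); last first.
  by move=> t _; rewrite mulr2n; ring.
by rewrite -mulr_sumr sum_increments0 ?mulr0.
Qed.

(** The squares of a martingale grow by the energies met on the way. *)
Lemma walk_sqr f c n x : harmonic_fun f ->
  walk n (fun y => (f y - c) ^+ 2) x =
  \sum_(k < n) walk k (energy f f) x + (f x - c) ^+ 2.
Proof.
move=> fh; elim: n => [|n IHn]; first by rewrite big_ord0 add0r.
rewrite walkSr (eq_walk _ _ _ (fun y => avg_sqr c y fh)) walkD IHn.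
by rewrite big_ord_recr/= addrCA addrA.
Qed.

(** A harmonic f has mean f t under the law from t, and mean f 1 under the law with
a random first step. So the increment is the integral of f - f 1 against the
difference of the laws, and Cauchy-Schwarz with respect to the second law
applies. *)
Lemma sqr_increment_le f n t : harmonic_fun f -> t \in T ->
  (f t - f 1%g) ^+ 2 <= chi2 n t * \sum_(k < n.+1) walk k (energy f f) 1%g.
Proof.
move=> fh tT; set c := f 1%g; set q := trans_prob n.+1 1%g; set p := trans_prob n t.
have uA := @reach_uniq _ T n.+1.
have A1 y : y \in reach n.+1 -> (1 * y)%g \in reach n.+1 by rewrite mul1g.
have At y : y \in reach n -> (t * y)%g \in reach n.+1.
  by move=> yn; exact: reachS.
have q0 y : 0 <= q y by exact: trans_ge0.
have -> : \sum_(k < n.+1) walk k (energy f f) 1%g =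
    \sum_(y <- reach n.+1) (Num.sqrt (q y) * (f y - c)) ^+ 2.
  transitivity (walk n.+1 (fun y => (f y - c) ^+ 2) 1%g).
    by rewrite walk_sqr// subrr expr0n addr0.
  rewrite (walkE _ uA A1); apply: eq_bigr => y _.
  by rewrite exprMn sqr_sqrtr.
have -> : chi2 n t = \sum_(y <- reach n.+1) ((p y - q y) / Num.sqrt (q y)) ^+ 2.
  by apply: eq_bigr => y _; rewrite exprMn exprVn sqr_sqrtr.
have -> : f t - c = \sum_(y <- reach n.+1)
    (p y - q y) / Num.sqrt (q y) * (Num.sqrt (q y) * (f y - c)).
  transitivity (\sum_(y <- reach n.+1) (p y - q y) * (f y - c)).
    transitivity (\sum_(y <- reach n.+1) (p y * (f y - c) - q y * (f y - c))).
      rewrite sumrB -!walkE// !walkB !walk_cst// !walk_harmonic//.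
      by rewrite /c subrr subr0.
    by apply: eq_bigr => y _; rewrite mulrBl.
  apply: eq_bigr => y _; have [qy0|qyn0] := eqVneq (q y) 0.
    have -> : p y = 0.
      apply/eqP; rewrite eq_le trans_ge0 andbT (le_trans (trans_step_le n y tT))//.
      by rewrite -/q qy0 mulr0.
    by rewrite qy0 subrr !mul0r.
  rewrite mulrA divfK// gt_eqF// sqrtr_gt0 lt_neqAle eq_sym qyn0/=; exact: q0.
exact: cauchy_schwarz_sum.
Qed.

Lemma energy_le_entropy f n x : harmonic_fun f ->
  energy f f x <= (N + 1) *+ 2 * (entropy n.+1 - entropy n)
    * \sum_(k < n.+1) walk k (energy f f) x.
Proof.
move=> fh; rewrite -[x]mulg1 -energy_translate.
under eq_bigr do rewrite -walk_translate.
set h := fun y => f (x * y)%g.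
have hh : harmonic_fun h by exact: harmonic_translate.
rewrite (eq_bigr (fun k : 'I_n.+1 => walk k (energy h h) 1%g)); last first.
  by move=> k _; apply: eq_walk => y; rewrite energy_translate.
apply: (@le_trans _ _ (N^-1 * \sum_(t <- T)
    (chi2 n t * \sum_(k < n.+1) walk k (energy h h) 1%g))).
  rewrite /energy ler_pM2l ?invr_gt0 ?sizeT_gt0//.
  rewrite big_seq [leRHS]big_seq; apply: ler_sum => t tT.
  by rewrite mul1g -expr2 sqr_increment_le.
rewrite -mulr_suml mulrA ler_wpM2r ?avg_chi2_le//.
apply: sumr_ge0 => k _; apply: walk_ge0 => y.
apply: (@avg_ge0 _ _ _ (fun z => (h z - h y) * (h z - h y))) => t _.
by rewrite -expr2 sqr_ge0.
Qed.

End Entropy.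

(** * Slow entropy growth, the reverse Poincare inequality and the Liouville property *)

Section Growth.
Context {R : realType} {G : groupType} (T : seq G) (T1 : 1%g \in T).
Implicit Types (f h : G -> R) (g s t x y z : G) (n : nat).

Local Notation avg := (@avg R G T).
Local Notation walk := (@walk R G T).
Local Notation reach := (@reach G T).
Local Notation N := ((size T)%:R : R).

Definition often_polynomial (C : R) (D : nat) :=
  forall m, exists2 n, (m <= n)%N & (size (reach n))%:R <= C * n.+1%:R ^+ D.

Lemma reach_size_gt0 n : 0 < (size (reach n))%:R :> R.
Proof. by rewrite ltr0n; have := one_reach T1 n; case: (reach n). Qed.

Lemma ln_step n : ln n.+2%:R - ln n.+1%:R <= n.+1%:R^-1 :> R.
Proof.
rewrite -ln_div ?posrE ?ltr0n//; apply: (le_trans (ln_leB1 _)).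
  by rewrite divr_gt0 ?ltr0n.
by rewrite -[n.+2]addn1 natrD mulrDl divff ?pnatr_eq0// mul1r addrC addrA addNr add0r.
Qed.

(** Otherwise the entropy would exceed (D + 1) ln n up to a constant, whereas it is
at most ln C + D ln (n + 1) at the radii where growth is polynomial. *)
Lemma entropy_slow_often (C : R) (D : nat) : often_polynomial C D ->
  forall m, exists2 n, (m <= n)%N &
    n.+1%:R * (entropy T n.+1 - entropy T n) <= D.+1%:R :> R.
Proof.
move=> grow m; apply: contrapT => fast.
pose v n : R := entropy T n - D.+1%:R * ln n.+1%:R.
have vS n : (m <= n)%N -> v n <= v n.+1.
  move=> mn; have : D.+1%:R < n.+1%:R * (entropy T n.+1 - entropy T n) :> R.
    by rewrite ltNge; apply/negP => slow; apply: fast; exists n.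
  rewrite mulrC -ltr_pdivrMr ?ltr0n// => lt_e.
  have := ler_wpM2l (ler0n R D.+1) (ln_step n); rewrite mulrBr => ln_e.
  by rewrite /v; move: lt_e ln_e; set a := D.+1%:R / _; lra.
have v_le n : (m <= n)%N -> v m <= v n.
  move=> /subnK <-; elim: (n - m)%N => // k IHk.
  by rewrite addSn (le_trans IHk)// vS// leq_addl.
have [k klarge] : exists k, expR (ln C - v m) < k%:R.
  exists (Num.truncn (expR (ln C - v m))).+1; exact: truncnS_gt.
have [n] := grow (maxn m k); rewrite geq_max => /andP[mn kn] growth_n.
have n1 : 0 < n.+1%:R ^+ D :> R by rewrite exprn_gt0 ?ltr0n.
have C0 : 0 < C.
  by rewrite -(pmulr_lgt0 _ n1) (lt_le_trans _ growth_n)// reach_size_gt0.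
have entn : entropy T n <= ln C + D%:R * ln n.+1%:R :> R.
  apply: (le_trans (entropy_le T1 n)).
  rewrite mulr_natl -lnXn ?ltr0n// -lnM ?posrE// ler_ln ?posrE ?reach_size_gt0//.
  by rewrite mulr_gt0.
have : ln C - v m < ln n.+1%:R.
  rewrite -ltr_expR lnK ?posrE ?ltr0n//; apply: (lt_le_trans klarge).
  by rewrite ler_nat leqW.
by have := v_le n mn; rewrite /v -natr1 mulrDl mul1r; lra.
Qed.

Definition time_avg n f x : R := n.+1%:R^-1 * \sum_(k < n.+1) walk k f x.

(** The name refers to the direction of the inequality: a local energy is bounded
by an average of energies on the scale n. *)
Definition reverse_poincare (K : R) n := forall f x, harmonic_fun T f ->
  energy T f f x <= K * time_avg n (energy T f f) x.

Lemma energy_ge0 f x : 0 <= energy T f f x.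
Proof.
apply: (@avg_ge0 _ _ _ (fun z => (f z - f x) * (f z - f x))) => t _.
by rewrite -expr2 sqr_ge0.
Qed.

Lemma reverse_poincare_often (C : R) (D : nat) : often_polynomial C D ->
  exists2 K : R, 0 <= K &
    forall m, exists2 n, (m <= n)%N & reverse_poincare K n.
Proof.
move=> grow; exists ((N + 1) *+ 2 * D.+1%:R).
  by rewrite mulr_ge0 ?mulrn_wge0 ?addr_ge0.
move=> m; have [n mn slow] := entropy_slow_often grow m; exists n => // f x fh.
apply: (le_trans (energy_le_entropy T1 n x fh)).
rewrite /time_avg mulrA ler_wpM2r//.
  by apply: sumr_ge0 => k _; apply: walk_ge0 => y; exact: energy_ge0.
rewrite -mulrA ler_wpM2l ?mulrn_wge0 ?addr_ge0//.
by rewrite ler_pdivlMr ?ltr0n// mulrC.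
Qed.

Context (K : R) (K0 : 0 <= K).
Context (rp : forall m, exists2 n, (m <= n)%N & reverse_poincare K n).
Context (genT : forall x, exists n, x \in reach n).

Lemma invariant_cst f : (forall x t, t \in T -> f (x * t)%g = f x) ->
  forall x, f x = f 1%g.
Proof.
move=> fT x; have [n xn] := genT x.
suff step y : f (y * x)%g = f y by rewrite -[x]mul1g step.
elim: n x xn y => [|n IHn] x xn y; move: xn.
  by rewrite inE => /eqP ->; rewrite mulg1.
by move=> /reachSP[t [w [tT wn ->]]]; rewrite mulgA IHn// fT.
Qed.

Lemma sqr_increment_le_energy f x t : t \in T ->
  (f (x * t)%g - f x) ^+ 2 <= N * energy T f f x.
Proof.
move=> tT; rewrite /energy mulrA mulfV ?gt_eqF ?sizeT_gt0// mul1r.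
rewrite (big_rem t)//= -expr2 lerDl sumr_ge0// => s _.
by rewrite -expr2 sqr_ge0.
Qed.

Lemma energy0_cst f : (forall x, energy T f f x = 0) -> forall x, f x = f 1%g.
Proof.
move=> f0; apply: invariant_cst => x t tT; apply/eqP.
rewrite -subr_eq0 -sqrf_eq0 eq_le sqr_ge0 andbT.
by rewrite (le_trans (sqr_increment_le_energy f x tT))// f0 mulr0.
Qed.

(** For f bounded by M the n + 1 energies on the right of the reverse Poincare
inequality sum to a variance, at most (2 M)^2, so their time average is O(1/n).
Hence the energy vanishes. *)
Lemma bounded_harmonic_cst f (M : R) : harmonic_fun T f ->
  (forall x, `|f x| <= M) -> forall x, f x = f 1%g.
Proof.
move=> fh fM; apply: energy0_cst => x; apply/eqP.
rewrite eq_le energy_ge0 andbT; apply/ler_addgt0Pr => e e0; rewrite add0r.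
set B := (M + M) ^+ 2.
have [m Bm] : exists m, K * B / e < m%:R.
  by exists (Num.truncn (K * B / e)).+1; exact: truncnS_gt.
have [n mn rpn] := rp m; apply: (le_trans (rpn f x fh)).
have : \sum_(k < n.+1) walk k (energy T f f) x <= B.
  have := walk_sqr T1 (f x) n.+1 x fh; rewrite subrr expr0n addr0 => <-.
  rewrite -[leRHS](walk_cst T1 n.+1 B x); apply: le_walk => y.
  rewrite -real_normK ?num_real// ler_sqr ?nnegrE//.
    by rewrite (le_trans (ler_normB _ _))// lerD.
  by rewrite addr_ge0// (le_trans _ (fM 1%g)).
move=> sumB; rewrite /time_avg mulrCA mulrC ler_pdivrMr ?ltr0n//.
apply: (@le_trans _ _ (K * B)); first exact: ler_wpM2l.
rewrite [leRHS]mulrC -ler_pdivrMr//; apply: (le_trans (ltW Bm)).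
by rewrite ler_nat leqW.
Qed.

End Growth.

(** * Limits along an ultrafilter, and finite dimension *)

Section AlongUltrafilter.
Context {R : realType}.

Lemma ultrafilter_along (P : nat -> Prop) :
  (forall m, exists2 n, (m <= n)%N & P n) ->
  exists U : set_system nat, [/\ UltraFilter U, U [set n | P n] &
    forall m, U [set n | (m <= n)%N]].
Proof.
move=> Pinf; pose B m := [set n | (m <= n)%N /\ P n].
have FB : ProperFilter (filter_from setT B).
  apply: filter_from_proper => [|m _]; last by have [n mn Pn] := Pinf m; exists n.
  apply: filter_fromT_filter; first by exists 0%N.
  move=> i j; exists (maxn i j) => n [].
  by rewrite geq_max => /andP[ni nj] Pn; split; split.
have [U [UU FU]] := ultraFilterLemma FB; exists U; split=> //.
  by apply: FU; exists 0%N => // n [].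
by move=> m; apply: FU; exists m => // n [].
Qed.

Context (U : set_system nat) {UU : UltraFilter U}.

Lemma bounded_ultra_cvg (u : nat -> R) (M : R) :
  (forall n, `|u n| <= M) -> exists l : R, u @ U --> l.
Proof.
move=> uM; have : (u @ U) `[(- M), M]%classic.
  by apply: (@filterE _ U) => n /=; rewrite in_itv/= -ler_norml.
move=> /segment_compact[l [_ lU]]; exists l => V Vl.
have [//|nV] := in_ultra_setVsetC (u @^-1` V) UU.
by have [y [/= ]] := lU (~` V) V nV Vl.
Qed.

Lemma cvg_lincomb (I : Type) (r : seq I) (a : I -> R) (u : I -> nat -> R)
    (l : I -> R) : (forall i, u i @ U --> l i) ->
  (\sum_(i <- r) a i * u i n) @[n --> U] --> \sum_(i <- r) a i * l i.
Proof.
move=> ul; apply: cvg_big => [|i _]; first exact: add_continuous.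
exact: cvgMr.
Qed.

Lemma limit0 (Ucof : forall m, U [set n | (m <= n)%N]) (u : nat -> R) (l B : R) :
  u @ U --> l -> (forall n, `|u n| <= B / n.+1%:R) -> l = 0.
Proof.
move=> ul uB; have small (e : R) : 0 < e -> U [set n | `|u n| <= e].
  move=> e0; have := Ucof (Num.truncn (B / e)); apply: filterS => n /= len.
  apply: (le_trans (uB n)); rewrite ler_pdivrMr ?ltr0n// mulrC -ler_pdivrMr//.
  apply: ltW; apply: (lt_le_trans (truncnS_gt _)).
  by rewrite ler_nat ltnS.
apply/eqP; rewrite -normr_le0; apply/ler_addgt0Pr => e e0; rewrite add0r.
exact: cvgr_to_le (cvg_norm ul) (small e e0).
Qed.

End AlongUltrafilter.

Section FiniteDimension.
Context {R : realType} {G : groupType} (T : seq G) (T1 : 1%g \in T).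
Implicit Types (f h : G -> R) (g s t x y z : G) (n : nat).

Local Notation avg := (@avg R G T).
Local Notation walk := (@walk R G T).
Local Notation reach := (@reach G T).
Local Notation time_avg := (@time_avg R G T).
Local Notation N := ((size T)%:R : R).

Lemma avg_bounded f (M : R) x : (forall t, t \in T -> `|f (x * t)%g| <= M) ->
  `|avg f x| <= M.
Proof.
move=> fM; rewrite /avg normrM ger0_norm ?invr_ge0// mulrC ler_pdivrMr ?sizeT_gt0//.
apply: (le_trans (ler_norm_sum _ _ _)).
have -> : M * N = \sum_(t <- T) M.
  by rewrite big_const_seq count_predT iter_addr_0 mulr_natr.
by rewrite big_seq [leRHS]big_seq; exact: ler_sum.
Qed.

Lemma time_avg_bounded n f (M : R) x : (forall y, `|f y| <= M) ->
  `|time_avg n f x| <= M.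
Proof.
move=> fM; rewrite /time_avg normrM ger0_norm ?invr_ge0// mulrC.
rewrite ler_pdivrMr ?ltr0n//; apply: (le_trans (ler_norm_sum _ _ _)).
have -> : M * n.+1%:R = \sum_(k < n.+1) M by rewrite sumr_const card_ord mulr_natr.
by apply: ler_sum => k _; exact: walk_bounded.
Qed.

Lemma time_avg_lincomb (I : Type) (r : seq I) n (a : I -> R) (f : I -> G -> R) x :
  time_avg n (fun y => \sum_(i <- r) a i * f i y) x =
  \sum_(i <- r) a i * time_avg n (f i) x.
Proof.
rewrite /time_avg; under eq_bigr do rewrite walk_sum.
rewrite exchange_big mulr_sumr; apply: eq_bigr => i _/=.
by under eq_bigr do rewrite walkZ; rewrite -mulr_sumr mulrCA.
Qed.

Lemma le_time_avg n f h x :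
  (forall y, f y <= h y) -> time_avg n f x <= time_avg n h x.
Proof.
move=> fh; rewrite /time_avg ler_pM2l ?invr_gt0 ?ltr0n//.
by apply: ler_sum => k _; exact: le_walk.
Qed.

Lemma time_avg_cst n (a : R) x : time_avg n (fun=> a) x = a.
Proof.
rewrite /time_avg; under eq_bigr do rewrite walk_cst//.
by rewrite sumr_const card_ord -[a *+ _]mulr_natl mulrA mulVf ?mul1r ?pnatr_eq0.
Qed.

(** Time averages are almost harmonic: one more step of the walk only changes the
first and the last term. *)
Lemma avg_time_avg n f x :
  avg (time_avg n f) x - time_avg n f x = (walk n.+1 f x - f x) / n.+1%:R.
Proof.
have -> : avg (time_avg n f) x = n.+1%:R^-1 * \sum_(k < n.+1) walk k.+1 f x.
  rewrite /avg /time_avg -mulr_sumr exchange_big mulrCA; congr (_ * _).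
  by rewrite mulr_sumr.
rewrite /time_avg -mulrBr -sumrB mulrC; congr (_ / _).
by rewrite -(big_mkord xpredT (fun k => walk k.+1 f x - walk k f x)) telescope_sumr.
Qed.

Lemma energyC f h x : energy T f h x = energy T h f x.
Proof. by rewrite /energy; under eq_bigr do rewrite mulrC. Qed.

Definition bounded_increments (L : R) f :=
  forall x t, t \in T -> `|f (x * t)%g - f x| <= L.

Lemma energy_bounded f h (L : R) x :
    bounded_increments L f -> bounded_increments L h ->
  `|energy T f h x| <= L ^+ 2.
Proof.
move=> fL hL; apply: (@avg_bounded (fun y => (f y - f x) * (h y - h x))) => t tT.
by rewrite normrM expr2 ler_pM// ?fL ?hL.
Qed.

Definition comb d (f : 'I_d -> G -> R) (c : 'rV[R]_d) (x : G) : R :=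
  \sum_i c 0 i * f i x.

Lemma comb_increment d (f : 'I_d -> G -> R) c x y :
  comb f c y - comb f c x = \sum_i c 0 i * (f i y - f i x).
Proof. by rewrite -sumrB; apply: eq_bigr => i _; rewrite mulrBr. Qed.

Lemma energy_comb d (f : 'I_d -> G -> R) c x : energy T (comb f c) (comb f c) x =
  \sum_(p : 'I_d * 'I_d) c 0 p.1 * c 0 p.2 * energy T (f p.1) (f p.2) x.
Proof.
rewrite -(pair_bigA _ (fun i j => c 0 i * c 0 j * energy T (f i) (f j) x))/=.
transitivity (N^-1 * \sum_(t <- T) \sum_i \sum_j
    c 0 i * c 0 j * ((f i (x * t)%g - f i x) * (f j (x * t)%g - f j x))).
  congr (_ * _); apply: eq_bigr => t _; rewrite comb_increment mulr_suml.
  apply: eq_bigr => i _; rewrite mulr_sumr; apply: eq_bigr => j _.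
  by rewrite mulrACA.
rewrite exchange_big mulr_sumr; apply: eq_bigr => i _/=.
rewrite exchange_big mulr_sumr; apply: eq_bigr => j _/=.
by rewrite -mulr_sumr mulrCA.
Qed.

Lemma harmonic_comb d (f : 'I_d -> G -> R) c :
  (forall i, harmonic_fun T (f i)) -> harmonic_fun T (comb f c).
Proof.
move=> fh x; transitivity (\sum_i c 0 i * avg (f i) x); last first.
  by apply: eq_bigr => i _; rewrite fh.
rewrite /avg exchange_big mulr_sumr; apply: eq_bigr => i _/=.
by rewrite -mulr_sumr mulrCA.
Qed.

Definition independent_mod_cst d (f : 'I_d -> G -> R) := forall c,
  (forall x, comb f c x = comb f c 1%g) -> c = 0.

Lemma quadratic_formE d (A : 'M[R]_d) (v : 'rV[R]_d) : (v *m A *m v^T) 0 0 =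
  \sum_(p : 'I_d * 'I_d) v 0 p.1 * v 0 p.2 * A p.1 p.2.
Proof.
rewrite -(pair_bigA _ (fun i j => v 0 i * v 0 j * A i j))/=.
rewrite mxE exchange_big; apply: eq_bigr => j _; rewrite mxE mulr_suml.
by apply: eq_bigr => i _; rewrite !mxE mulrAC.
Qed.

Context (K : R) (K0 : 0 <= K).
Context (rp : forall m, exists2 n, (m <= n)%N & reverse_poincare T K n).
Context (genT : forall x, exists n, x \in reach n).

(** Along an ultrafilter concentrated on the good times n, the time averages of the
energies converge at every base point. The limits are bounded harmonic functions
of the base point, hence constant by the Liouville property: this gives one
matrix M that controls the energies of all combinations at all points. *)
Lemma energy_matrix_exists d (f : 'I_d -> G -> R) (L : R) :
    (forall i, harmonic_fun T (f i)) -> (forall i, bounded_increments L (f i)) ->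
  exists U : set_system nat, exists M : 'M[R]_d, [/\ UltraFilter U,
    forall i j x, (fun n => time_avg n (energy T (f i) (f j)) x) @ U --> M i j &
    forall c x, energy T (comb f c) (comb f c) x <= K * (c *m M *m c^T) 0 0].
Proof.
move=> fh fL; have [U [UU Urp Ucof]] := ultrafilter_along rp.
pose E i j n x := time_avg n (energy T (f i) (f j)) x.
have Eb i j n x : `|E i j n x| <= L ^+ 2.
  by apply: time_avg_bounded => y; exact: energy_bounded.
pose M i j x := lim ((fun n => E i j n x) @ U).
have EM i j x : (fun n => E i j n x) @ U --> M i j x.
  have [l ul] := @bounded_ultra_cvg R U UU _ _ (fun n => Eb i j n x).
  exact: (cvgP l ul).
have Mh i j : harmonic_fun T (M i j).
  move=> x; apply/eqP; rewrite -subr_eq0; apply/eqP.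
  apply: (@limit0 _ U _ Ucof (fun n => avg (E i j n) x - E i j n x) _
    (L ^+ 2 + L ^+ 2)).
    apply: cvgB => //; rewrite /avg mulr_sumr.
    under eq_cvg do rewrite /avg mulr_sumr.
    exact: (@cvg_lincomb R U UU G T (fun=> N^-1) (fun t n => E i j n (x * t)%g)).
  move=> n; rewrite avg_time_avg normrM [X in _ * X]ger0_norm ?invr_ge0//.
  rewrite ler_wpM2r ?invr_ge0// (le_trans (ler_normB _ _))// lerD//.
    by apply: walk_bounded => // y; exact: energy_bounded.
  exact: energy_bounded.
have Mb i j x : `|M i j x| <= L ^+ 2.
  by apply: (cvgr_to_le (cvg_norm (EM i j x))); apply: filterE => n; exact: Eb.
have Mc i j x : M i j x = M i j 1%g.
  exact: (bounded_harmonic_cst T1 K0 rp genT (Mh i j) (Mb i j)).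
exists U, (\matrix_(i, j) M i j 1%g); split=> // [i j x|c x].
  by rewrite mxE -(Mc i j x); exact: EM.
rewrite quadratic_formE; under eq_bigr do rewrite mxE.
have eE n : time_avg n (energy T (comb f c) (comb f c)) x =
    \sum_(p : 'I_d * 'I_d) c 0 p.1 * c 0 p.2 * E p.1 p.2 n x.
  by rewrite -time_avg_lincomb; congr time_avg; apply/funext => y; exact: energy_comb.
apply: (@cvgr_to_ge _ U _ _ (fun n => K *
    \sum_(p : 'I_d * 'I_d) c 0 p.1 * c 0 p.2 * E p.1 p.2 n x)); last first.
  by apply: filterS Urp => n; rewrite -eE; apply; exact: harmonic_comb.
apply: cvgMr; apply: cvg_lincomb => p; rewrite -(Mc _ _ x); exact: EM.
Qed.

(** The form c M c^T dominates the energies of all combinations, so M is invertible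
by independence modulo constants. Dually, the form of M^-1 is at most K N on every
vector u of increments. Its average over the walk is tr (M^-1 M) = d. *)
Lemma size_independent_le d (f : 'I_d -> G -> R) (L : R) :
    (forall i, harmonic_fun T (f i)) -> (forall i, bounded_increments L (f i)) ->
  independent_mod_cst f -> d%:R <= K * N.
Proof.
move=> fh fL find; have [U [M [UU EM Mq]]] := energy_matrix_exists fh fL.
have Munit : M \in unitmx.
  rewrite -row_free_unit; apply: inj_row_free => c cM; apply: find.
  apply: (energy0_cst T1 genT) => x; apply/eqP; rewrite eq_le energy_ge0 andbT.
  by apply: (le_trans (Mq c x)); rewrite cM mul0mx mxE mulr0.
pose W := invmx M.
pose u x t : 'rV[R]_d := \row_i (f i (x * t)%g - f i x).
(* The combination with coefficients c = u M^-1 has both its increment and its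
   form c M c^T equal to s = u M^-1 u^T, so s^2 <= N K s. *)
have uWu x t : t \in T -> (u x t *m W *m (u x t)^T) 0 0 <= K * N.
  move=> tT; set s := (_ *m _) 0 0; pose c := u x t *m W.
  have cu : comb f c (x * t)%g - comb f c x = s.
    rewrite comb_increment /s mxE; apply: eq_bigr => i _.
    by congr (_ * _); rewrite !mxE.
  have cMc : (c *m M *m c^T) 0 0 = s.
    have -> : c *m M *m c^T = (u x t *m W *m (u x t)^T)^T.
      by rewrite /c mulmxKV// [RHS]trmx_mul trmxK.
    by rewrite mxE.
  have := sqr_increment_le_energy T1 (comb f c) x tT; rewrite cu => s2.
  have {}s2 : s ^+ 2 <= N * (K * s).
    by apply: (le_trans s2); rewrite ler_wpM2l// -cMc Mq.
  have [s0|s0] := leP s 0; first by rewrite (le_trans s0)// mulr_ge0.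
  by rewrite -(ler_pM2r s0) -expr2 (le_trans s2)// mulrA (mulrC N).
have We x : \sum_(p : 'I_d * 'I_d) W p.1 p.2 * energy T (f p.1) (f p.2) x <= K * N.
  rewrite -[K * N](@avg_cst R _ _ T1 _ x).
  rewrite [leLHS](_ : _ = N^-1 * \sum_(t <- T) (u x t *m W *m (u x t)^T) 0 0).
    rewrite /avg ler_pM2l ?invr_gt0 ?sizeT_gt0// big_seq [leRHS]big_seq.
    by apply: ler_sum => t tT; exact: uWu.
  under [in RHS]eq_bigr do rewrite quadratic_formE.
  rewrite exchange_big mulr_sumr; apply: eq_bigr => p _/=.
  rewrite /energy mulrCA mulr_sumr; congr (_ * _).
  by apply: eq_bigr => t _; rewrite !mxE mulrC.
have Msym i j : M i j = M j i.
  have eC : energy T (f i) (f j) = energy T (f j) (f i).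
    by apply/funext => x; exact: energyC.
  have cl k l := cvg_lim (@Rhausdorff R) (EM k l 1%g).
  by rewrite -(cl _ i j) eC (cl _ j i).
have trE : \tr (W *m M) = \sum_(p : 'I_d * 'I_d) W p.1 p.2 * M p.1 p.2.
  rewrite -(pair_bigA _ (fun i j => W i j * M i j))/=; apply: eq_bigr => i _.
  by rewrite mxE; apply: eq_bigr => j _; rewrite Msym.
have <- : \tr (W *m M) = d%:R by rewrite mulVmx// mxtrace1.
rewrite trE; pose E (p : 'I_d * 'I_d) := energy T (f p.1) (f p.2).
apply: (@cvgr_to_le _ U _ _ (fun n =>
  \sum_(p : 'I_d * 'I_d) W p.1 p.2 * time_avg n (E p) 1%g)).
  by apply: cvg_lincomb => p; exact: EM.
apply: filterE => n; rewrite -time_avg_lincomb -(time_avg_cst n (K * N) 1%g).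
by apply: le_time_avg => x; exact: We.
Qed.

End FiniteDimension.

(** * Sequences without geometric decay, and the Gram kernel of a symmetric walk *)

Section Decay.
Context {R : realType}.

Lemma bernoulli_le (x : R) n : 0 <= x <= 1 -> 1 - n%:R * x <= (1 - x) ^+ n.
Proof.
move=> /andP[x0 x1]; elim: n => [|n IHn]; first by rewrite mul0r subr0 expr0.
rewrite exprS; apply: (@le_trans _ _ ((1 - x) * (1 - n%:R * x))).
  rewrite -natr1; have : 0 <= n%:R * x ^+ 2 by rewrite mulr_ge0// sqr_ge0.
  by rewrite expr2; lra.
by apply: ler_wpM2l => //; rewrite subr_ge0.
Qed.

(** Multiplied by (k + 1)^(P + 1), a geometrically decaying sequence becomes
eventually nonincreasing, by Bernoulli's inequality, and so stays bounded; the
lower bound along a sequence would make it exceed a multiple of k + 1. *)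
Lemma no_geometric_decay (u : nat -> R) (A e : R) (P : nat) :
    0 < e -> e <= 1 -> 0 <= A -> (forall k, 0 <= u k) ->
    (forall k, u k.+1 <= (1 - e) * u k) ->
  ~ (forall m, exists2 k, (m <= k)%N & 1 <= A * k.+1%:R ^+ P * u k).
Proof.
move=> e0 e1 A0 u0 uS ularge.
have [k0 k0P] : exists k, P.+1%:R / e < k%:R.
  by exists (Num.truncn (P.+1%:R / e)).+1; exact: truncnS_gt.
pose w k : R := k.+1%:R ^+ P.+1 * u k.
(* Beyond k0 the loss (P + 1) / (k + 2) in Bernoulli's inequality is below e. *)
have wS k : (k0 <= k)%N -> w k.+1 <= w k.
  move=> k0k; rewrite /w.
  apply: (@le_trans _ _ (k.+2%:R ^+ P.+1 * ((1 - e) * u k))).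
    by rewrite ler_wpM2l ?exprn_ge0.
  rewrite mulrA ler_wpM2r//; pose x : R := k.+2%:R^-1.
  have x01 : 0 <= x <= 1 by rewrite invr_ge0 ler0n invf_le1 ?ltr0n// ler1n.
  have -> : k.+1%:R = k.+2%:R * (1 - x) :> R.
    by rewrite mulrBr mulr1 mulfV ?pnatr_eq0// -[in RHS]natr1 addrK.
  rewrite exprMn ler_pM2l ?exprn_gt0 ?ltr0n//.
  apply: (le_trans _ (bernoulli_le P.+1 x01)).
  rewrite lerD2l lerN2 /x ler_pdivrMr ?ltr0n// mulrC -ler_pdivrMr//.
  by apply: (le_trans (ltW k0P)); rewrite ler_nat !leqW.
have w_le k : (k0 <= k)%N -> w k <= w k0.
  move=> /subnK <-; elim: (k - k0)%N => // j IHj.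
  by rewrite addSn (le_trans _ IHj)// wS// leq_addl.
have [m mP] : exists m, A * w k0 < m%:R.
  by exists (Num.truncn (A * w k0)).+1; exact: truncnS_gt.
have [k] := ularge (maxn k0 m); rewrite geq_max => /andP[k0k mk] uk.
have : k.+1%:R <= A * w k.
  rewrite /w exprS -[leLHS]mulr1 (_ : A * _ = k.+1%:R * (A * k.+1%:R ^+ P * u k)).
    by rewrite ler_wpM2l.
  by rewrite !mulrA; congr (_ * _ * _); rewrite mulrC.
move=> /le_trans /(_ (ler_wpM2l A0 (w_le k k0k))).
move=> /le_lt_trans /(_ mP); rewrite ltr_nat => km.
by have := leq_trans km mk; rewrite ltnNge leqnSn.
Qed.

End Decay.

Lemma seq_argmax (R : realDomainType) (X : eqType) (f : X -> R) (r : seq X) :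
  r != [::] ->
  exists2 s, s \in r & forall t, t \in r -> f t <= f s.
Proof.
elim: r => // x [|y r] IHr _.
  by exists x; rewrite ?mem_head// => t; rewrite inE => /eqP ->.
have [//|s sr smax] := IHr.
have [fsx|fxs] := leP (f s) (f x).
  exists x; first exact: mem_head.
  by move=> t; rewrite inE => /predU1P[->//|/smax/le_trans]; apply.
exists s; first by rewrite inE sr orbT.
by move=> t; rewrite inE => /predU1P[->|/smax//]; rewrite ltW.
Qed.

Section Kernel.
Context {R : realType} {G : groupType} (T : seq G) (T1 : 1%g \in T).
Context (Tsym : perm_eq [seq x^-1%g | x <- T] T).
Implicit Types (f h : G -> R) (g s t x y z : G) (k m n : nat).

Local Notation avg := (@avg R G T).
Local Notation walk := (@walk R G T).
Local Notation trans_prob := (@trans_prob R G T).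
Local Notation reach := (@reach G T).
Local Notation N := ((size T)%:R : R).

(** Symmetry of the steps allows the last step, rather than the first one, to be
split off. *)
Lemma transSr n x y :
  trans_prob n.+1 x y = N^-1 * \sum_(t <- T) trans_prob n x (y * t)%g.
Proof.
rewrite /trans_prob walkSr -walk_sum -walkZ; apply: eq_walk => z.
congr (_ * _); rewrite -(perm_big _ Tsym)/= big_map; apply: eq_bigr => t _.
by rewrite -[in RHS](inj_eq (mulIg t^-1%g)) mulgK.
Qed.

Lemma trans_sym n x y : trans_prob n x y = trans_prob n y x.
Proof.
elim: n x y => [|n IHn] x y; first by rewrite !trans0 eq_sym.
by rewrite transSr transS; under eq_bigr do rewrite IHn.
Qed.

(** A pair a = (k, x) stands for the function trans_prob k x on G, and overlap a b
is the inner product of two such functions, by sum_transM. *)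
Definition overlap (a b : nat * G) : R := trans_prob (a.1 + b.1) a.2 b.2.

Lemma sum_transM (A : seq G) (a b : nat * G) : uniq A ->
  (forall y, y \in reach a.1 -> (a.2 * y)%g \in A) ->
  \sum_(y <- A) trans_prob a.1 a.2 y * trans_prob b.1 b.2 y = overlap a b.
Proof.
move=> uA aA; rewrite -(walkE (fun y => trans_prob b.1 b.2 y) uA aA).
by rewrite /overlap /trans_prob walk_add; apply: eq_walk => y; exact: trans_sym.
Qed.

(** The inner product of the differences a - b and c - d. It is written through
transition probabilities, so that no summation set has to be carried along. *)
Definition diff_form (a b c d : nat * G) : R :=
  overlap a c - overlap a d - overlap b c + overlap b d.

Definition support (a : nat * G) : seq G := [seq (a.2 * y)%g | y <- reach a.1].

Lemma diff_form_sum (A : seq G) a b c d : uniq A ->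
    {subset support a <= A} -> {subset support b <= A} ->
  diff_form a b c d = \sum_(y <- A) (trans_prob a.1 a.2 y - trans_prob b.1 b.2 y) *
                                    (trans_prob c.1 c.2 y - trans_prob d.1 d.2 y).
Proof.
move=> uA aA bA; have aA' y : y \in reach a.1 -> (a.2 * y)%g \in A.
  by move=> yr; apply: aA; exact: map_f.
have bA' y : y \in reach b.1 -> (b.2 * y)%g \in A.
  by move=> yr; apply: bA; exact: map_f.
rewrite /diff_form -!(sum_transM _ uA aA') -!(sum_transM _ uA bA').
by rewrite -!sumrB -big_split/=; apply: eq_bigr => y _; ring.
Qed.

Lemma diff_form_cs a b c d :
  diff_form a b c d ^+ 2 <= diff_form a b a b * diff_form c d c d.
Proof.
pose A := undup (support a ++ support b ++ support c ++ support d).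
have sub e : e \in [:: a; b; c; d] -> {subset support e <= A}.
  move=> eabcd y ye; rewrite mem_undup !mem_cat.
  by move: eabcd; rewrite !inE => /or4P[] /eqP <-; rewrite ye ?orbT.
have [aA bA cA dA] : [/\ {subset support a <= A}, {subset support b <= A},
    {subset support c <= A} & {subset support d <= A}].
  by split; apply: sub; rewrite !inE eqxx ?orbT.
rewrite !(diff_form_sum _ _ (undup_uniq _ : uniq A))//.
under [X in _ <= X * _]eq_bigr do rewrite -expr2.
under [X in _ <= _ * X]eq_bigr do rewrite -expr2.
exact: cauchy_schwarz_sum.
Qed.

Lemma diff_form_ge0 a b : 0 <= diff_form a b a b.
Proof.
pose A := undup (support a ++ support b).
rewrite (diff_form_sum _ _ (undup_uniq _ : uniq A)) => [|y|y]; last 2 first.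
- by rewrite mem_undup mem_cat => ->.
- by rewrite mem_undup mem_cat => ->; rewrite orbT.
by apply: sumr_ge0 => y _; rewrite -expr2 sqr_ge0.
Qed.

End Kernel.

(** * A lower bound for the decay of the return probability *)

Section SmallLaplacian.
Context {R : realType} {G : groupType} (T0 : seq G) (T01 : 1%g \in T0).
Context (T0sym : perm_eq [seq x^-1%g | x <- T0] T0).

(** The walk rests with probability at least one half. This makes its Markov
operator nonnegative on l^2 when the steps are symmetric, which drop_lazy uses. *)
Definition lazy_steps := nseq (size T0) 1%g ++ T0.
Local Notation T := lazy_steps.

Lemma lazy_steps1 : 1%g \in T.
Proof. by rewrite mem_cat T01 orbT. Qed.

Lemma lazy_steps_sym : perm_eq [seq x^-1%g | x <- T] T.
Proof. by rewrite map_cat map_nseq invg1 perm_cat2l. Qed.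

Local Notation T1 := lazy_steps1.
Local Notation Tsym := lazy_steps_sym.

Implicit Types (f h : G -> R) (g s t x y z w : G) (k m n : nat).

Local Notation avg := (@avg R G T).
Local Notation trans_prob := (@trans_prob R G T).
Local Notation reach := (@reach G T).
Local Notation diff_form := (@diff_form R G T).
Local Notation N := ((size T)%:R : R).

Definition return_prob n : R := trans_prob n 1%g 1%g.
Local Notation ret := return_prob.

(** At even times 2k this is, up to the factor 2, the mean squared length of the
displacements of the law at time k by one step (sum_displacement). *)
Definition return_drop n : R := ret n - ret n.+1.

(** The squared l^2 distance between the law of the walk at time k from x and the
one from the identity. *)
Definition displacement k x : R := diff_form (k, x) (k, 1%g) (k, x) (k, 1%g).
Local Notation disp := displacement.

Lemma trans_diag n x : trans_prob n x x = ret n.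
Proof. by rewrite -{1 2}[x]mulg1 trans_translate. Qed.

Lemma displacementE k x : disp k x = (ret (k + k) - trans_prob (k + k) x 1%g) *+ 2.
Proof.
rewrite /displacement /diff_form /overlap/= !trans_diag (trans_sym Tsym _ 1%g x).
by rewrite mulr2n; ring.
Qed.

Lemma displacement_ge0 k x : 0 <= disp k x.
Proof. exact: diff_form_ge0 Tsym _ _. Qed.

Lemma displacement1 k : disp k 1%g = 0.
Proof. by rewrite displacementE subrr mul0rn. Qed.

(** The distance is translation invariant, so this is the expansion of the square
|u + v|^2, where u and v are the differences of laws for xy and x, and for x
and 1. *)
Lemma displacementM k x y : disp k (x * y)%g =
  disp k y + disp k x + diff_form (k, (x * y)%g) (k, x) (k, x) (k, 1%g) *+ 2.
Proof.
rewrite !displacementE /diff_form /overlap/= trans_diag.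
have -> : trans_prob (k + k) (x * y)%g x = trans_prob (k + k) y 1%g.
  by rewrite -{2}[x]mulg1 trans_translate.
by rewrite !mulr2n; ring.
Qed.

Lemma diff_form_translate k g x y z w :
  diff_form (k, g * x)%g (k, g * y)%g (k, g * z)%g (k, g * w)%g =
  diff_form (k, x) (k, y) (k, z) (k, w).
Proof. by rewrite /diff_form /overlap/= !trans_translate. Qed.

Lemma sum_displacement k : \sum_(t <- T) disp k t = N * return_drop (k + k) *+ 2.
Proof.
under eq_bigr do rewrite displacementE.
rewrite sumrMnl sumrB big_const_seq count_predT iter_addr_0; congr (_ *+ _).
rewrite /return_drop mulrBr -[ret _ *+ _]mulr_natl; congr (_ - _).
rewrite /return_prob transS mulrA mulfV ?mul1r ?gt_eqF ?sizeT_gt0 ?T1//.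
by apply: eq_bigr => t _; rewrite mul1g.
Qed.

Lemma drop_ge0 k : 0 <= return_drop (k + k).
Proof.
have : 0 <= N * return_drop (k + k) *+ 2.
  by rewrite -sum_displacement sumr_ge0// => t _; exact: displacement_ge0.
by rewrite pmulrn_lge0// pmulr_rge0// sizeT_gt0 ?T1.
Qed.

(** The triangle inequality along a path of n steps. The sum of the displacements
over all steps serves as a bound for each of them. *)
Lemma displacement_reach k n x : x \in reach n ->
  disp k x <= n%:R ^+ 2 * (N * return_drop (k + k) *+ 2).
Proof.
set B := N * return_drop (k + k) *+ 2.
have B0 : 0 <= B by rewrite mulrn_wge0 ?mulr_ge0 ?drop_ge0.
elim: n x => [|n IHn] x.
  by rewrite inE => /eqP ->; rewrite displacement1 expr0n mul0r.
move=> /reachSP[t [w [tT wn ->]]]; rewrite displacementM.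
have dw := IHn _ wn.
have dt : disp k t <= B.
  rewrite /B -sum_displacement (big_rem t)//= lerDl sumr_ge0// => s _.
  exact: displacement_ge0.
set c := diff_form _ _ _ _.
have : c ^+ 2 <= (n%:R * B) ^+ 2.
  apply: (le_trans (diff_form_cs Tsym _ _ _ _)).
  have -> : diff_form (k, t * w)%g (k, t) (k, t * w)%g (k, t) = disp k w.
    by rewrite /displacement -(diff_form_translate k t w 1%g w 1%g) mulg1.
  rewrite expr2 mulrACA -expr2 mulrA.
  by apply: ler_pM; rewrite ?displacement_ge0.
have nB0 : 0 <= n%:R * B by rewrite mulr_ge0.
move=> c2; have cB : c <= n%:R * B.
  apply: (le_trans (ler_norm c)).
  by rewrite -ler_sqr ?nnegrE// real_normK ?num_real.
rewrite -natr1 sqrrD1 !mulrDl mul1r mulrnAl mulr2n; lra.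
Qed.

Context (genT : forall x, exists n, x \in reach n).
Context (infG : infinite_set [set: G]).

Lemma exists_far n : exists2 x, x \in reach n.+1 & x \notin reach n.
Proof.
apply: contrapT => nofar; apply: infG.
have sub x : x \in reach n.+1 -> x \in reach n.
  by move=> xn; apply: contrapT => /negP xn'; apply: nofar; exists x.
have all_reach x : x \in reach n.
  have [m] := genT x; elim: m x => [|m IHm] x.
    by rewrite inE => /eqP ->; exact: one_reach T1 n.
  move=> /reachSP[t [w [tT wm ->]]]; apply: sub; apply: reachS => //.
  exact: IHm.
apply: (@sub_finite_set _ _ [set` reach n]); first by move=> x _; exact: all_reach.
exact: finite_seq.
Qed.

(** A probability law on |reach k| points has squared l^2 norm at least the inverse
of that number. *)
Lemma return_prob_ge k : 1 <= (size (reach k))%:R * ret (k + k).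
Proof.
have r1 y : y \in reach k -> (1 * y)%g \in reach k by rewrite mul1g.
have <- : \sum_(y <- reach k) trans_prob k 1%g y * trans_prob k 1%g y = ret (k + k).
  exact: (@sum_transM R G T Tsym _ (k, 1%g) (k, 1%g) (reach_uniq T k) r1).
have := cauchy_schwarz_sum (reach k) (fun=> 1) (trans_prob k 1%g).
under eq_bigr do rewrite mul1r.
rewrite (sum_trans T1 (reach_uniq T k) r1) expr1n.
by rewrite big_const_seq count_predT iter_addr_0.
Qed.

(** The laws at time k from 1 and from a point out of reach in 2k steps are
orthogonal, so their squared distance is twice the return probability. *)
Lemma drop_lower k :
  1 <= (size (reach k))%:R * k.+1%:R ^+ 2 * (N *+ 4) * return_drop (k + k).
Proof.
have [x xk xNk] := exists_far (k + k).
have := displacement_reach k xk.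
have -> : disp k x = ret (k + k) *+ 2.
  rewrite displacementE (trans_sym Tsym).
  have /eqP -> : trans_prob (k + k) 1%g x == 0; last by rewrite subr0.
  apply: contraNT xNk => tx; apply: (@trans_support R _ _ _ 1%g).
  by rewrite mul1g.
rewrite mulrnAr lerMn2r/= => ret_le.
apply: (le_trans (return_prob_ge k)); rewrite -!mulrA ler_pM2l ?reach_size_gt0 ?T1//.
apply: (le_trans ret_le).
(* The factor 4 absorbs the passage from 2k + 1 to 2 (k + 1). *)
rewrite [leRHS](_ : _ = (k.+1%:R *+ 2) ^+ 2 * (N * return_drop (k + k))); last first.
  by rewrite -mulr_natr -[_ *+ 2]mulr_natr; ring.
rewrite ler_wpM2r ?mulr_ge0 ?drop_ge0// ler_sqr ?nnegrE ?mulrn_wge0//.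
by rewrite -mulrnA ler_nat muln2 -addnn addSn ltnS addnS leqnSn.
Qed.

End SmallLaplacian.

(** * Existence of a nonconstant Lipschitz harmonic function *)

Section HarmonicFunction.
Context {R : realType} {G : groupType} (T0 : seq G) (T01 : 1%g \in T0).
Context (T0sym : perm_eq [seq x^-1%g | x <- T0] T0).

Local Notation T := (lazy_steps T0).
Local Notation T1 := (lazy_steps1 T01).
Local Notation Tsym := (lazy_steps_sym T0sym).

Implicit Types (f h : G -> R) (g s t x y z w : G) (k m n : nat).

Local Notation avg := (@avg R G T).
Local Notation trans_prob := (@trans_prob R G T).
Local Notation reach := (@reach G T).
Local Notation diff_form := (@diff_form R G T).
Local Notation N := ((size T)%:R : R).
Local Notation ret := (@return_prob R G T0).
Local Notation return_drop := (@return_drop R G T0).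
Local Notation disp := (@displacement R G T0).

(** The inner product of translates, by x and by y, of the Laplacian of the law at
time k. *)
Definition lap_form k x y : R := diff_form (k, x) (k.+1, x) (k, y) (k.+1, y).

Lemma lap_formE k x y : lap_form k x y =
  trans_prob (k + k) x y - trans_prob (k + k).+1 x y *+ 2 + trans_prob (k + k).+2 x y.
Proof.
rewrite /lap_form /diff_form /overlap/= ?addnS ?addSn ?addnS.
by rewrite mulr2n; ring.
Qed.

Lemma lap_form1 k : lap_form k 1%g 1%g = return_drop (k + k) - return_drop (k + k).+1.
Proof. by rewrite lap_formE /return_drop /return_prob mulr2n; ring. Qed.

Lemma lap_form_diag k x : lap_form k x x = lap_form k 1%g 1%g.
Proof. by rewrite !lap_formE !trans_diag. Qed.

(** The difference of the two sides is <P g, g> for g the Laplacian of the law at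
time k. For each remaining step t there is one resting step; their joint
contribution is |g|^2 + <t.g, g>, up to the factor 1 / |T|, and this is
nonnegative by Cauchy-Schwarz. *)
Lemma drop_lazy k : return_drop (k + k).+2 <= return_drop (k + k).+1.
Proof.
rewrite -subr_ge0.
have -> : return_drop (k + k).+1 - return_drop (k + k).+2 =
    N^-1 * \sum_(t <- T) lap_form k t 1%g.
  under eq_bigr do rewrite lap_formE.
  rewrite big_split sumrB/= sumrMnl mulrDr mulrBr mulrnAr.
  have retS n : N^-1 * \sum_(t <- T) trans_prob n t 1%g = ret n.+1.
    by rewrite /return_prob transS; under [in RHS]eq_bigr do rewrite mul1g.
  by rewrite !retS /return_drop mulr2n; ring.
rewrite mulr_ge0 ?invr_ge0// /lazy_steps big_cat/=.
rewrite big_nseq iter_addr_0 addrC.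
have -> : lap_form k 1%g 1%g *+ size T0 = \sum_(t <- T0) lap_form k 1%g 1%g.
  by rewrite big_const_seq count_predT iter_addr_0.
rewrite -big_split/= sumr_ge0// => t _.
have c0 : 0 <= lap_form k 1%g 1%g by exact: diff_form_ge0 Tsym _ _.
have : lap_form k t 1%g ^+ 2 <= lap_form k t t * lap_form k 1%g 1%g.
  exact: diff_form_cs Tsym _ _ _ _.
rewrite lap_form_diag -expr2 -[X in X <= _]real_normK ?num_real//.
rewrite ler_sqr ?nnegrE// ler_norml => /andP[] /[swap] _; lra.
Qed.

Context (genT : forall x, exists n, x \in reach n).
Context (infG : infinite_set [set: G]).
Context (C : R) (D : nat) (growT : often_polynomial T C D).

Lemma drop_gt0 k : 0 < return_drop (k + k).
Proof.
rewrite lt_neqAle drop_ge0// andbT eq_sym; apply/eqP => d0.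
have := drop_lower T01 T0sym genT infG k (R := R).
by rewrite d0 mulr0 ler10.
Qed.

(** The ratio of lap_form k 1 1 to the drop at time 2k is the relative decrease of
the drop from time 2k to 2k + 1. By laziness the drop does not increase at the
next step, so a lower bound on all these ratios would make it decay
geometrically. *)
Lemma small_laplacian (e : R) : 0 < e -> e <= 1 ->
  exists k, lap_form k 1%g 1%g <= e * return_drop (k + k).
Proof.
move=> e0 e1; apply: contrapT => big.
have C0 : 0 <= C.
  have [n _ nP] := growT 0%N.
  have n1 : 0 < n.+1%:R ^+ D :> R by rewrite exprn_gt0 ?ltr0n.
  by rewrite -(pmulr_lge0 _ n1) (le_trans _ nP).
apply: (@no_geometric_decay R (fun k => return_drop (k + k))
  (C * (N *+ 4)) e D.+2) => //.
- by rewrite mulr_ge0// mulrn_wge0.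
- by move=> k; rewrite ltW// drop_gt0.
- move=> k; rewrite addSn addnS; apply: (le_trans (drop_lazy k)).
  have : e * return_drop (k + k) < lap_form k 1%g 1%g.
    by rewrite ltNge; apply/negP => le_k; apply: big; exists k.
  by rewrite lap_form1 mulrBl mul1r; lra.
- move=> m; have [n mn nP] := growT m; exists n => //.
  apply: (le_trans (drop_lower T01 T0sym genT infG n)).
  rewrite ler_wpM2r ?drop_ge0//.
  rewrite [leRHS](_ : _ = C * n.+1%:R ^+ D * n.+1%:R ^+ 2 * (N *+ 4)); last first.
    by rewrite -[D.+2]addn2 exprD; ring.
  by rewrite ler_wpM2r ?mulrn_wge0// ler_wpM2r ?exprn_ge0.
Qed.

(** Matrix coefficients of the translation action on l^2. Choosing the step s that
displaces the law most gives the Lipschitz constant 1, and its displacement is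
at least the mean one, which dominates the Laplacian by small_laplacian. *)
Lemma almost_harmonic (e : R) : 0 < e -> e <= 1 ->
  exists h, [/\ h 1%g = 0, bounded_increments T 1 h,
    forall x, (avg h x - h x) ^+ 2 <= e & exists2 s, s \in T & h s = 1].
Proof.
move=> e0 e1; have [k kP] := small_laplacian e0 e1.
have Tn0 : T != [::] by apply/eqP => TE; have := T1; rewrite TE.
have [s sT smax] := seq_argmax (disp k) Tn0.
have N0 : 0 < N by exact: sizeT_gt0 T1.
have disp_s : return_drop (k + k) <= disp k s.
  have : \sum_(t <- T) disp k t <= N * disp k s.
    have -> : N * disp k s = \sum_(t <- T) disp k s.
      by rewrite big_const_seq count_predT iter_addr_0 mulr_natl.
    by rewrite big_seq [leRHS]big_seq; apply: ler_sum => t; exact: smax.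
  rewrite sum_displacement// -mulrnAr ler_pM2l// => /(le_trans _); apply.
  by rewrite mulr2n lerDl drop_ge0.
have b0 : 0 < disp k s by rewrite (lt_le_trans (drop_gt0 k)).
pose h x := diff_form (k, x) (k, 1%g) (k, s) (k, 1%g) / disp k s.
have h_diff x y : h y - h x = diff_form (k, y) (k, x) (k, s) (k, 1%g) / disp k s.
  by rewrite /h -mulrBl /diff_form; congr (_ / _); ring.
exists h; split.
- by rewrite /h /diff_form; rewrite [X in X / _](_ : _ = 0) ?mul0r//; ring.
- move=> x t tT; rewrite h_diff normrM normfV [X in _ / X]gtr0_norm//.
  rewrite ler_pdivrMr// mul1r -ler_sqr ?nnegrE ?(ltW b0)// real_normK ?num_real//.
  apply: (le_trans (diff_form_cs Tsym _ _ _ _)).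
  rewrite expr2 ler_pM ?(diff_form_ge0 Tsym)//.
  apply: (le_trans _ (smax t tT)).
  by rewrite /displacement -(diff_form_translate T0 k x t 1%g t 1%g) mulg1.
- move=> x.
  have -> : avg h x - h x =
      diff_form (k.+1, x) (k, x) (k, s) (k, 1%g) / disp k s.
    rewrite /avg; under eq_bigr do rewrite /h.
    rewrite -mulr_suml mulrA -mulrBl; congr (_ / _).
    rewrite /diff_form /overlap/= ?addSn !big_split/= !sumrN !transS.
    have cst (a : R) : N^-1 * \sum_(t <- T) a = a.
      exact: (@avg_cst R G T T1 a 1%g).
    by rewrite !mulrDr !mulrN !cst; ring.
  rewrite exprMn exprVn ler_pdivrMr ?exprn_gt0//.
  apply: (le_trans (diff_form_cs Tsym _ _ _ _)).
  rewrite expr2 mulrA ler_pM2r//.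
  have -> : diff_form (k.+1, x) (k, x) (k.+1, x) (k, x) = lap_form k 1%g 1%g.
    by rewrite -(lap_form_diag k x) /lap_form /diff_form; ring.
  by rewrite (le_trans kP)// ler_wpM2l// ltW.
- by exists s => //; rewrite /h divff// gt_eqF.
Qed.

Lemma increments_reach (L : R) f n x : bounded_increments T L f ->
  x \in reach n -> forall y, `|f (y * x)%g - f y| <= n%:R * L.
Proof.
move=> fL; elim: n x => [|n IHn] x.
  by rewrite inE => /eqP -> y; rewrite mulg1 subrr normr0 mul0r.
move=> /reachSP[t [w [tT wn ->]]] y.
rewrite mulgA -[f _](subrK (f (y * t)%g)) -addrA.
rewrite (le_trans (ler_normD _ _))// -natr1 mulrDl mul1r lerD// ?fL//.
exact: IHn.
Qed.

(** A pointwise limit of almost harmonic functions. The step at which they equal 1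
may vary, but the sum of their absolute values over all steps stays at least 1,
which prevents the limit from being constant. *)
Lemma nonconstant_harmonic_exists : exists h,
  [/\ harmonic_fun T h, bounded_increments T 1 h & exists x, h x != h 1%g].
Proof.
have step n : exists h, [/\ h 1%g = 0, bounded_increments T 1 h,
    forall x, (avg h x - h x) ^+ 2 <= (1 / n.+1%:R) ^+ 2 &
    exists2 s, s \in T & h s = 1].
  apply: almost_harmonic; first by rewrite exprn_gt0// divr_gt0// ltr0n.
  by rewrite exprn_ile1 ?divr_ge0// ler_pdivrMr ?ltr0n// mul1r ler1n.
have [h hP] := choice step.
have [U [UU _ Ucof]] : exists U : set_system nat, [/\ UltraFilter U,
    U [set n | True] & forall m, U [set n | (m <= n)%N]].
  by apply: (ultrafilter_along (P := fun=> True)) => m; exists m.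
have h_cvg x : exists l : R, (fun n => h n x) @ U --> l.
  have [m xm] := genT x; apply: (@bounded_ultra_cvg R U UU _ m%:R) => n.
  have [h1 hL _ _] := hP n.
  by have := increments_reach hL xm 1%g; rewrite mul1g h1 subr0 mulr1.
have [H HU] := choice h_cvg.
exists H; split.
- move=> x; apply/eqP; rewrite -subr_eq0; apply/eqP.
  apply: (@limit0 _ U _ Ucof (fun n => avg (h n) x - h n x) _ 1).
    apply: cvgB => //; rewrite /avg mulr_sumr.
    under eq_cvg do rewrite /avg mulr_sumr.
    exact: (@cvg_lincomb R U UU G T (fun=> N^-1) (fun t n => h n (x * t)%g)).
  move=> n; have [_ _ hh _] := hP n.
  by rewrite -ler_sqr ?nnegrE ?divr_ge0// real_normK ?num_real.
- move=> x t tT.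
  apply: (cvgr_to_le (cvg_norm (cvgB (HU (x * t)%g) (HU x)))).
  by apply: filterE => n; have [_ hL _ _] := hP n; exact: hL.
apply: contrapT => Hcst.
have H0 x : H x = 0.
  have -> : H x = H 1%g by apply: contrapT => /eqP Hx; apply: Hcst; exists x.
  apply: (limit0 Ucof (HU 1%g) (B := 0)) => n.
  by have [-> _ _ _] := hP n; rewrite normr0 mul0r.
have : 1 <= \sum_(t <- T) 1 * `|H t|.
  have HT := @cvg_lincomb R U UU G T (fun=> 1) (fun t n => `|h n t|)
    (fun t => `|H t|) (fun t => cvg_norm (HU t)).
  apply: (@cvgr_to_ge _ U _ _ (fun n => \sum_(t <- T) 1 * `|h n t|) _ _ (HT _)).
  apply: filterE => n; have [_ _ _ [s sT hs]] := hP n.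
  by rewrite (big_rem s)//= hs normr1 mulr1 lerDl sumr_ge0//.
by rewrite big1 ?ler10// => t _; rewrite H0 normr0 mulr0.
Qed.

End HarmonicFunction.

(** * From harmonic functions to a linear representation *)

Section Representation.
Context {R : realType} {G : groupType} (T : seq G) (T1 : 1%g \in T).
Implicit Types (f h : G -> R) (g s t x y z w : G) (k m n : nat).
Local Notation reach := (@reach G T).

Context (genT : forall x, exists n, x \in reach n).

(** At a maximum the increments are nonpositive and have mean zero, so they vanish,
and generation spreads the maximum over the group. *)
Lemma harmonic_max_cst h y : harmonic_fun T h -> (forall x, h x <= h y) ->
  forall x, h x = h y.
Proof.
move=> hh hy.
have step z t : t \in T -> h z = h y -> h (z * t)%g = h y.
  move=> tT hz; have : \sum_(s <- T) (h y - h (z * s)%g) == 0.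
    rewrite -oppr_eq0 -sumrN -[X in _ == X](sum_increments0 T1 z hh).
    by apply/eqP; apply: eq_bigr => s _; rewrite opprB hz.
  rewrite psumr_eq0 => [/allP/(_ t tT)/=|s _]; last by rewrite subr_ge0.
  by rewrite subr_eq0 => /eqP.
have reach_max n w z : w \in reach n -> h z = h y -> h (z * w)%g = h y.
  elim: n w z => [|n IHn] w z; first by rewrite inE => /eqP ->; rewrite mulg1.
  by move=> /reachSP[t [v [tT vn ->]]] hz; rewrite mulgA IHn// step.
by move=> x; have [n] := genT (y^-1 * x)%g => /reach_max/(_ (erefl (h y)));
  rewrite mulVKg.
Qed.

Lemma finite_range_harmonic_cst h : harmonic_fun T h -> finite_set (range h) ->
  forall x, h x = h 1%g.
Proof.
move=> hh /finite_seqP[r hr].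
have r0 : r != [::].
  have : [set` r] (h 1%g) by rewrite -hr; exists 1%g.
  by case: r {hr}.
have [M Mr rM] := seq_argmax id r0.
have [y _ hy] : range h M by rewrite hr.
have hmax x : h x <= h y.
  by rewrite hy rM//; have : range h (h x); [exists x|rewrite hr].
by move=> x; rewrite !(harmonic_max_cst hh hmax).
Qed.

Definition lipschitz_harmonic f :=
  harmonic_fun T f /\ exists L : R, bounded_increments T L f.

Lemma lipschitz_harmonic_translate g f : lipschitz_harmonic f ->
  lipschitz_harmonic (fun x => f (g * x)%g).
Proof.
move=> [fh [L fL]]; split; first exact: harmonic_translate.
by exists L => x t tT; rewrite mulgA; exact: fL.
Qed.

Definition coordinates n (F : G -> 'cV[R]_n) :=
  [/\ forall i, lipschitz_harmonic (fun x => F x i 0),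
      forall v : 'rV_n, (forall x, v *m F x = 0) -> v = 0 &
      forall h, lipschitz_harmonic h ->
        exists v : 'rV_n, forall x, h x = (v *m F x) 0 0].

Context (K : R) (K0 : 0 <= K).
Context (rp : forall m, exists2 n, (m <= n)%N & reverse_poincare T K n).

Definition independent_family d (f : 'I_d -> G -> R) :=
  (forall i, lipschitz_harmonic (f i)) /\ independent_mod_cst f.

Lemma independent_family_size d (f : 'I_d -> G -> R) : independent_family f ->
  (d <= Num.truncn (K * (size T)%:R))%N.
Proof.
move=> [fLH find]; have fh i := (fLH i).1.
have [L fL] := choice (fun i => (fLH i).2).
have fL' i : bounded_increments T (\sum_j `|L j|) (f i).
  move=> x t tT; apply: (le_trans (fL i x t tT)).
  by rewrite (bigD1 i)//= (le_trans (ler_norm _))// lerDl sumr_ge0.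
have := size_independent_le T1 K0 rp genT fh fL' find.
by rewrite -truncn_ge_nat// mulr_ge0.
Qed.

Definition cons_family d (h : G -> R) (f : 'I_d -> G -> R) (i : 'I_d.+1) :=
  if unlift ord0 i is Some j then f j else h.

Lemma comb_cons d h (f : 'I_d -> G -> R) (c : 'rV_d.+1) x :
  comb (cons_family h f) c x =
  c 0 0 * h x + comb f (\row_j c 0 (lift ord0 j)) x.
Proof.
rewrite /comb big_ord_recl /cons_family unlift_none; congr (_ + _).
by apply: eq_bigr => j _; rewrite liftK mxE.
Qed.

(** A family independent modulo constants, of maximal size, together with the
constant function 1. By maximality any further function has a nonzero
coefficient in some relation modulo constants. *)
Lemma coordinates_exist : exists d, exists F : G -> 'cV[R]_d.+1, coordinates F.
Proof.
pose P d := `[< exists f : 'I_d -> G -> R, independent_family f >].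
have P0 : exists d, P d.
  exists 0%N; apply/asboolP; exists (fun _ _ => 0); split; first by case.
  by move=> c _; apply/rowP => -[].
have Pmax d : P d -> (d <= Num.truncn (K * (size T)%:R))%N.
  by move=> /asboolP[f]; exact: independent_family_size.
case: (ex_maxnP P0 Pmax) => d /asboolP[f [fLH find]] dmax.
have cstLH : lipschitz_harmonic (fun=> 1).
  split; first by move=> x; exact: avg_cst.
  by exists 0 => x t _; rewrite subrr normr0.
pose F x : 'cV[R]_d.+1 := \col_i cons_family (fun=> 1) f i x.
have FE (v : 'rV_d.+1) x : (v *m F x) 0 0 =
    v 0 0 + comb f (\row_j v 0 (lift ord0 j)) x.
  transitivity (comb (cons_family (fun=> 1) f) v x); last first.
    by rewrite comb_cons mulr1.
  by rewrite mxE; apply: eq_bigr => i _; rewrite mxE.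
exists d, F; split.
- move=> i; under eq_fun do rewrite mxE; rewrite /cons_family.
  by case: unliftP => [j _|_].
- move=> v vF; have {}vF x : v 0 0 + comb f (\row_j v 0 (lift ord0 j)) x = 0.
    by rewrite -FE vF mxE.
  have c0 : \row_j v 0 (lift ord0 j) = 0.
    by apply: find => x; apply: (addrI (v 0 0)); rewrite !vF.
  have v0 : v 0 0 = 0.
    have := vF 1%g; rewrite c0 /comb big1 ?addr0// => i _.
    by rewrite mxE mul0r.
  apply/rowP => i; rewrite mxE; case: (unliftP ord0 i) => [j ->|->//].
  by have /rowP/(_ j) := c0; rewrite !mxE.
move=> h hLH; pose f' := cons_family h f.
have f'LH i : lipschitz_harmonic (f' i).
  by rewrite /f' /cons_family; case: unliftP => [j _|_].
have /existsNP[c /not_implyP[ccst cn0]] : ~ independent_mod_cst f'.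
  move=> f'ind; suff : (d.+1 <= d)%N by rewrite ltnn.
  by apply: dmax; apply/asboolP; exists f'.
have c00 : c 0 0 != 0.
  apply/eqP => c00; apply: cn0.
  have c0 : \row_j c 0 (lift ord0 j) = 0.
    by apply: find => x; have := ccst x; rewrite !comb_cons c00 !mul0r !add0r.
  apply/rowP => i; rewrite mxE; case: (unliftP ord0 i) => [j ->|->//].
  by have /rowP/(_ j) := c0; rewrite !mxE.
set b := comb f' c 1%g in ccst.
(* The relation among h and the f_i modulo constants, solved for h. *)
exists (\row_i ((c 0 0)^-1 * (if i == ord0 then b else - c 0 i))) => x.
rewrite FE mxE eqxx.
have -> : comb f (\row_j (\row_i ((c 0 0)^-1 *
      (if i == ord0 then b else - c 0 i))) 0 (lift ord0 j)) x =
    - ((c 0 0)^-1 * comb f (\row_j c 0 (lift ord0 j)) x).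
  by rewrite mulr_sumr -sumrN; apply: eq_bigr => j _; rewrite !mxE /=; ring.
by rewrite -(ccst x) comb_cons mulrDr mulKf// addrK.
Qed.

(** The coordinate vector is a left equivariant map: the rows of A g are the
coordinates of the left translates by g of the entries of F. *)
Lemma coordinates_translation n (F : G -> 'cV[R]_n) : coordinates F ->
  exists A : G -> 'M[R]_n, [/\ forall g x, A g *m F x = F (g * x)%g,
    A 1%g = 1%:M & forall g g', A (g * g')%g = A g *m A g'].
Proof.
move=> [FLH Find Fspan].
have rowE g i : exists v : 'rV_n, forall x, F (g * x)%g i 0 = (v *m F x) 0 0.
  exact: Fspan (lipschitz_harmonic_translate g (FLH i)).
have rowsE g : exists v : 'I_n -> 'rV_n,
    forall i x, F (g * x)%g i 0 = (v i *m F x) 0 0.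
  by have [v] := choice (rowE g); exists v.
have [v vP] := choice rowsE.
pose A g : 'M[R]_n := \matrix_i v g i.
have AF g x : A g *m F x = F (g * x)%g.
  apply/colP => i; rewrite vP !mxE.
  by apply: eq_bigr => j _; rewrite mxE.
have Ainj (B C : 'M[R]_n) : (forall x, B *m F x = C *m F x) -> B = C.
  move=> BC; apply/row_matrixP => i; apply/eqP; rewrite -subr_eq0; apply/eqP.
  by apply: Find => x; rewrite mulmxBl -!row_mul BC subrr.
exists A; split=> //.
  by apply: Ainj => x; rewrite AF mul1g mul1mx.
by move=> g g'; apply: Ainj => x; rewrite -mulmxA !AF mulgA.
Qed.

(** Since h x = v A x F(1), finitely many matrices A x would leave h finitely many
values, and a harmonic function with finitely many values is constant. *)
Lemma infinite_linear_image h : lipschitz_harmonic h -> (exists x, h x != h 1%g) ->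
  exists n : nat, (0 < n)%N /\
    exists phi : {multiplicative G -> GL n R}, infinite_set (range phi).
Proof.
move=> hLH [y hy]; have [d [F FP]] := coordinates_exist.
have [A [AF A1 AM]] := coordinates_translation FP.
have Aunit g : A g \in unitmx.
  by have /mulmx1_unit[] : A g *m A g^-1%g = 1%:M by rewrite -AM mulgV.
pose phi g := MkGL (Aunit g).
have phiM : {morph phi : x y / (x * y)%g}.
  by move=> g g'; apply: val_inj; rewrite /= AM.
pose Phi : {multiplicative G -> GL d.+1 R} :=
  HB.pack phi (isMultiplicative.Build G (GL d.+1 R) phi phiM).
exists d.+1; split=> //; exists Phi => fin_phi.
have [_ _ /(_ h hLH)[v vP]] := FP.
move/eqP: hy; apply; apply: finite_range_harmonic_cst => //; first exact: hLH.1.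
apply: (@sub_finite_set _ _
    ((fun B : GL d.+1 R => (v *m (GLmx B *m F 1%g)) 0 0) @` range Phi)).
  move=> _ [x _ <-]; exists (phi x); first by exists x.
  by rewrite /= AF mulg1 vP.
exact: finite_image.
Qed.

End Representation.

(** * Word growth *)

Section WordNormGrowth.
Context {G : groupType} (S : {fset G}).

Definition sym_steps : seq G := 1%g :: (S ++ [seq x^-1%g | x <- S]).
Local Notation T := (lazy_steps sym_steps).

Lemma sym_steps_sym : perm_eq [seq x^-1%g | x <- sym_steps] sym_steps.
Proof.
rewrite /sym_steps map_cons invg1 perm_cons map_cat -map_comp.
by rewrite (@eq_map _ _ _ id (@invgK G)) map_id perm_catC.
Qed.

Lemma mem_steps x : (x \in T) = (x == 1%g) || (x \in S) || (x^-1%g \in S).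
Proof.
rewrite mem_cat mem_nseq /= inE mem_cat.
have -> : (x \in [seq y^-1%g | y <- S]) = (x^-1%g \in S).
  apply/mapP/idP => [[y yS ->]|xS]; first by rewrite invgK.
  by exists x^-1%g; rewrite ?invgK.
by case: (x == 1%g); rewrite //= !orbA.
Qed.

Lemma reach_spelled n x : x \in reach T n -> exists2 k, (k <= n)%N & spelled S x k.
Proof.
elim: n x => [|n IHn] x.
  by rewrite inE => /eqP ->; exists 0%N => //; exists [::]; rewrite big_nil.
move=> /reachSP[t [y [tT /IHn[k kn [w [wS sw pw]]] ->]]].
have [->|t1] := eqVneq t 1%g.
  by exists k; [exact: leqW | exists w; split=> //; rewrite mul1g].
exists k.+1 => //; exists (t :: w); rewrite /= sw big_cons pw; split=> //.
by move: tT; rewrite mem_steps (negbTE t1)/= => ->.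
Qed.

Context (genS : generates S).

Lemma generates_reach x : exists n, x \in reach T n.
Proof.
have [k [w [wS _ <-]]] := genS x; exists (size w).
elim: w wS => [|t w IHw] /=; first by rewrite big_nil mem_head.
move=> /andP[tS wS]; rewrite big_cons; apply: reachS; last exact: IHw.
by rewrite mem_steps -orbA tS orbT.
Qed.

Context {R : realType}.

Lemma reach_size_le_growth n (r : R) : n%:R <= r ->
  (size (reach T n) <= growth genS r)%N.
Proof.
move=> nr; apply: uniq_leq_size => [|x xn]; first exact: reach_uniq.
rewrite in_fset_set; last exact: finite_word_ball.
rewrite inE /word_ball /= /word_norm; case: ex_minnP => k _ kmin.
apply: le_trans nr; rewrite ler_nat.
have [j jn xj] := reach_spelled xn.
by apply: leq_trans jn; apply: kmin; apply/asboolP.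
Qed.

(** A finite lower limit at infinity gives arbitrarily large real radii r where the
growth is at most c r^d; it remains to pass to the integer part of r and to an
integer exponent above d. *)
Lemma weakly_polynomial_often : weakly_polynomial_growth R genS ->
  exists C : R, exists D, often_polynomial T C D.
Proof.
move=> [d d0]; rewrite limf_einfE => sup_fin.
(* Any real number above the lower limit; the lower limit itself might be
   minus infinity. *)
have [c supc] : exists c : R, (ereal_sup [set ereal_inf
    [set ((growth genS r)%:R / r `^ d)%:E | r in V] | V in pinfty_nbhs R]
    < c%:E)%E.
  move: sup_fin; case: ereal_sup => [s _| |] //.
    by exists (s + 1); rewrite lte_fin ltrDl.
  by exists 0; rewrite ltNyr.
exists c, (Num.truncn d).+1 => m.
pose V := [set r : R | m.+1%:R < r].
have VF : pinfty_nbhs R V by exists m.+1%:R; split=> //; exact: num_real.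
have : (ereal_inf [set ((growth genS r)%:R / r `^ d)%:E | r in V] < c%:E)%E.
  by apply: le_lt_trans supc; apply: ereal_sup_ubound; exists V.
move=> /ereal_inf_lt[_ [r /= mr <-]]; rewrite lte_fin.
have r1 : 1 <= r by rewrite (le_trans _ (ltW mr))// ler1n.
have r0 : 0 <= r by rewrite (le_trans _ r1).
have rd0 : 0 < r `^ d by rewrite powR_gt0 ?(lt_le_trans _ r1).
rewrite ltr_pdivrMr// => growth_r.
exists (Num.truncn r).
  by rewrite truncn_ge_nat// (le_trans _ (ltW mr))// ler_nat.
have c0 : 0 <= c by rewrite -(pmulr_lge0 _ rd0) (le_trans _ (ltW growth_r)).
have size_le : (size (reach T (Num.truncn r)))%:R <= (growth genS r)%:R :> R.
  by rewrite ler_nat reach_size_le_growth// truncn_le.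
apply: (le_trans size_le); apply: (le_trans (ltW growth_r)).
apply: ler_wpM2l => //; apply: (@le_trans _ _ (r `^ (Num.truncn d).+1%:R)).
  by apply: ler_powR => //; rewrite ltW// truncnS_gt.
rewrite powR_mulrn// lerXn2r ?nnegrE//.
by rewrite ltW// truncnS_gt.
Qed.

End WordNormGrowth.

Theorem corollary1p5 (R : realType) (G : groupType) (S : {fset G})
    (genS : generates S) :
  infinite_set [set: G] ->
  weakly_polynomial_growth R genS ->
  exists n : nat, (0 < n)%N /\
    exists phi : {multiplicative G -> GL n R}, infinite_set (range phi).
Proof.
move=> infG growS.
have T01 : 1%g \in sym_steps S by exact: mem_head.
have T1 := lazy_steps1 T01.
have genT := generates_reach genS.
have [C [D growT]] := weakly_polynomial_often growS.
have [K K0 rp] := reverse_poincare_often T1 growT.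
have [h [hh hL h_ncst]] :=
  nonconstant_harmonic_exists T01 (sym_steps_sym S) genT infG growT.
apply: (infinite_linear_image T1 genT K0 rp _ h_ncst).
by split; last by exists 1.
Qed.
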